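(* Let $\mathbf{M}_0\in\mathbb{C}^{n\times n}$ be Hermitian positive definite. There exist global constants $c_1,c_2,c_3$ such that for all $\epsilon\in(0,1)$, if algorithm $\mathsf{CHOL}$ below is executed on $\mathbf{M}_0$ on a floating point machine with unit roundoff $$\mathbf{u}\le\epsilon\,\frac{1}{c_1n^{c_2}\kappa(\mathbf{M}_0)^{c_3\log n}},$$ then it does not break down due to loss of positive definiteness, and the returned lower triangular $\mathbf{L}$ satisfies $\|\mathbf{L}\mathbf{L}^*-\mathbf{M}_0\|\le\epsilon\|\mathbf{M}_0\|$; this corresponds to $\log(1/\mathbf{u})=O(\log(n)\log(\kappa(\mathbf{M}_0))+\log(1/\epsilon))$ bits of precision. Here $\mathsf{CHOL}(\mathbf{M})$, for $\mathbf{M}=\begin{pmatrix}\mathbf{A}&\mathbf{B}^*\\ \mathbf{B}&\mathbf{C}\end{pmatrix}$ with $n/2\times n/2$ blocks: if $n=1$ return $\mathrm{fl}(\sqrt{\mathbf{M}_{1,1}})$; otherwise $\mathbf{L}_{11}=\mathsf{CHOL}(\mathbf{A})$, $\mathbf{W}=\mathsf{MM}(\mathbf{B},\mathsf{INV}(\mathbf{A}))$, $\mathbf{L}_{21}=\mathsf{MM}(\mathbf{W},\mathbf{L}_{11})$, $\widetilde{\mathbf{S}}=\mathrm{fl}(\mathbf{C}-\mathsf{HERM}(\mathsf{MM}(\mathbf{W},\mathbf{B}^* )))$, $\mathbf{L}_{22}=\mathsf{CHOL}(\widetilde{\mathbf{S}})$, return $\begin{pmatrix}\mathbf{L}_{11}&0\\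 \mathbf{L}_{21}&\mathbf{L}_{22}\end{pmatrix}$.
   Context: $n$ is a power of 2; $\kappa(\mathbf{X})=\|\mathbf{X}\|\|\mathbf{X}^{-1}\|$ in spectral norm. Floating point model: $\mathrm{fl}(a\odot b)=(1+\delta)(a\odot b)$ with $|\delta|\le\mathbf{u}$ for $\odot\in\{+,-,\times,/,\sqrt{\cdot}\}$, entrywise for matrices. $\mathsf{MM}$: $\|\mathsf{MM}(\mathbf{X},\mathbf{Y})-\mathbf{X}\mathbf{Y}\|\le\mu_{\mathsf{MM}}(n)\mathbf{u}\|\mathbf{X}\|\|\mathbf{Y}\|$ with $\mu_{\mathsf{MM}}(n)=n^{c_\eta}$, cost $T_{\mathsf{MM}}(n)=O(n^{\omega+\eta})$. $\mathsf{INV}$: $\|\mathsf{INV}(\mathbf{X})-\mathbf{X}^{-1}\|\le\mu_{\mathsf{INV}}(n)\mathbf{u}\,\kappa(\mathbf{X})^{c_{\mathsf{INV}}\log n}\|\mathbf{X}^{-1}\|$ with $\mu_{\mathsf{INV}}(n)$ polynomial in $n$, constant $c_{\mathsf{INV}}\le8$, cost $O(T_{\mathsf{MM}}(n))$. $\mathsf{HERM}(\mathbf{X})$ replaces the strictly lower triangular part of $\mathbf{X}$ by the conjugate transpose of its strictly upper triangular part.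
   Formalization: The O-bound on log(1/u) is proved for κ(M_0) ≥ κ_0, any fixed κ_0 > 1 (constant depending on κ_0), as it fails for M_0 = I, ε fixed, n → ∞; positive definiteness of computed, possibly non-Hermitian, Schur complements means Re(x*Mx) > 0. *)

(* Defs.v *)
From HB Require Import structures.
From mathcomp Require Import all_boot all_order all_algebra.
From mathcomp Require Import sesquilinear spectral.
From mathcomp Require Import all_classical all_reals all_analysis.
From mathcomp Require Import complex.

Set Implicit Arguments.
Unset Strict Implicit.
Unset Printing Implicit Defensive.

Import Order.TTheory GRing.Theory Num.Theory.
Import Normc.

Local Open Scope classical_set_scope.
Local Open Scope ring_scope.
Local Open Scope sesquilinear_scope.
Local Open Scope complex_scope.

(* The dimension n = 2 ^ k, in a form whose successor case is definitionally
   a sum, so that the block operations apply without casts. *)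
Fixpoint pow2 (k : nat) : nat :=
  if k is k'.+1 then (pow2 k' + pow2 k')%N else 1%N.

Lemma pow2E (k : nat) : pow2 k = (2 ^ k)%N.
Proof. by elim: k => //= k ->; rewrite expnS mul2n addnn. Qed.

Section Matrices.
Variable R : realType.
Implicit Type n : nat.

Definition log2 (x : R) : R := ln x / ln 2.

Definition vnorm n (x : 'cV[R[i]]_n) : R :=
  Num.sqrt (\sum_i normc (x i 0) ^+ 2).

Definition specnorm n (A : 'M[R[i]]_n) : R :=
  sup [set vnorm (A *m x) | x in [set x : 'cV[R[i]]_n | vnorm x <= 1]].

Definition cond n (A : 'M[R[i]]_n) : R := specnorm A * specnorm (invmx A).

(* No symmetry is required here, so that the predicate still makes sense for
   the computed Schur complements, which rounding may leave non-Hermitian (the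
   diagonal of a computed W * B^* need not be real).  On Hermitian matrices the
   quadratic form is real and this is the usual notion. *)
Definition posdefmx n (M : 'M[R[i]]_n) : Prop :=
  forall x : 'cV[R[i]]_n, x != 0 -> 0 < complex.Re ((x ^t* *m M *m x) 0 0).

Definition hermposdefmx n (M : 'M[R[i]]_n) : Prop :=
  M \is hermsymmx /\ posdefmx M.

Definition HERM n (X : 'M[R[i]]_n) : 'M[R[i]]_n :=
  \matrix_(i, j) if (j < i)%N then (X j i)^* else X i j.

Definition rounds_to (u : R) (z w : R[i]) : Prop :=
  exists delta : R[i], normc delta <= u /\ w = (1 + delta) * z.

Definition poly_bounded (mu : nat -> R) : Prop :=
  exists a b : R, forall n, (0 < n)%N -> mu n <= a * n%:R `^ b.

(* A floating point machine together with its MM and INV routines, for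
   mu_MM(n) = n ^ ceta, the function mu_INV = muINV and the constant
   c_INV = cINV. *)
Record machine (ceta cINV : R) (muINV : nat -> R) := Machine {
  unit_roundoff : R;
  fl_add : R[i] -> R[i] -> R[i];
  fl_sub : R[i] -> R[i] -> R[i];
  fl_mul : R[i] -> R[i] -> R[i];
  fl_div : R[i] -> R[i] -> R[i];
  fl_sqrt : R[i] -> R[i];
  MM : forall k, 'M[R[i]]_(pow2 k) -> 'M[R[i]]_(pow2 k) -> 'M[R[i]]_(pow2 k);
  INV : forall k, 'M[R[i]]_(pow2 k) -> 'M[R[i]]_(pow2 k);
  unit_roundoff_gt0 : 0 < unit_roundoff;
  fl_addP : forall a b, rounds_to unit_roundoff (a + b) (fl_add a b);
  fl_subP : forall a b, rounds_to unit_roundoff (a - b) (fl_sub a b);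
  fl_mulP : forall a b, rounds_to unit_roundoff (a * b) (fl_mul a b);
  fl_divP : forall a b, b != 0 -> rounds_to unit_roundoff (a / b) (fl_div a b);
  fl_sqrtP : forall a, rounds_to unit_roundoff (sqrtc a) (fl_sqrt a);
  MM_P : forall k (X Y : 'M[R[i]]_(pow2 k)),
    specnorm (MM X Y - X *m Y) <=
      (pow2 k)%:R `^ ceta * unit_roundoff * specnorm X * specnorm Y;
  INV_P : forall k (X : 'M[R[i]]_(pow2 k)), X \in unitmx ->
    specnorm (INV X - invmx X) <=
      muINV (pow2 k) * unit_roundoff *
      cond X `^ (cINV * log2 (pow2 k)%:R) * specnorm (invmx X)
}.

Section Cholesky.
Variables (ceta cINV : R) (muINV : nat -> R) (m : machine ceta cINV muINV).

Definition fl_submx n (A B : 'M[R[i]]_n) : 'M[R[i]]_n :=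
  \matrix_(i, j) fl_sub m (A i j) (B i j).

(* [None] is a breakdown: CHOL was called on a matrix that is not positive
   definite.  For a 1 x 1 matrix this is the failure of the square root. *)
Fixpoint CHOL (k : nat) : 'M[R[i]]_(pow2 k) -> option 'M[R[i]]_(pow2 k) :=
  match k with
  | 0 => fun M : 'M[R[i]]_1 =>
      if `[< posdefmx M >] then Some (fl_sqrt m (M 0 0))%:M else None
  | k'.+1 => fun M : 'M[R[i]]_(pow2 k' + pow2 k') =>
      if `[< posdefmx M >] then
        let A := ulsubmx M in
        let B := dlsubmx M in
        let C := drsubmx M in
        if CHOL A is Some L11 then
          let W := MM m B (INV m A) in
          let L21 := MM m W L11 in
          let S := fl_submx C (HERM (MM m W (B ^t*))) in
          if CHOL S is Some L22 then Some (block_mx L11 0 L21 L22) else None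
        else None
      else None
  end.

End Cholesky.

Definition chol_roundoff (c1 c2 c3 : R) n (M : 'M[R[i]]_n) (eps : R) : R :=
  eps * (1 / (c1 * n%:R `^ c2 * cond M `^ (c3 * log2 n%:R))).

End Matrices.

(* Main.v *)
(** A call of CHOL receives a matrix [M] at distance [theta * lam] from a
    Hermitian [M'] whose quadratic form lies between [lam] and [kap * lam].  Schur
    complements of [M'] obey the same bounds.  The computed Schur complement is
    compared to the Hermitian matrix [S' = C' - HERMre X] rather than to the exact
    Schur complement: its distance to [S'] is [O(kap^2)] times [theta * lam],
    while the dimension-dependent error of [HERM] only moves the reference matrix
    from the exact Schur complement to [S'], which a slack in the bounds on the
    form absorbs.  Comparing to the exact Schur complement would multiply
    [theta] by [n^2] at each of the [log n] levels.  The error of [L L^*]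
    satisfies a recurrence with factor [O(kap^3)], read off its four blocks, and
    so ends up bounded by [n^O(1) * kap^O(log n) * u]. *)

Require Import Defs.
From mathcomp Require Import all_boot all_order all_algebra.
From mathcomp Require Import sesquilinear spectral.
From mathcomp Require Import all_classical all_reals all_analysis.
From mathcomp Require Import complex.
From mathcomp Require Import ring lra.

Set Implicit Arguments.
Unset Strict Implicit.
Unset Printing Implicit Defensive.

Import Order.TTheory GRing.Theory Num.Theory.
Import Normc.
Local Open Scope ring_scope.
Local Open Scope sesquilinear_scope.
Local Open Scope complex_scope.
Local Notation Re := complex.Re.
Local Notation Im := complex.Im.

(** A factor [n^(2 log n)] would not fit under [c1 * n^c2 * cond^(c3 log n)]. The scale [lam] and
    the ratio [kap] stay the same at every level. Hence every matrix passed to [INV] has condition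
    number at most [4 * kap], and a single number [w] bounds the relative errors of all routines at
    all levels. For [M0] itself the form is bounded by [2 * lam] from below and [kap * lam / 2] from
    above; these factors 2 leave room for the slack and make [kap = 4 * cond M0]. One quantity,
    [q * E^k * theta] with [E = 1000 * kap^3], serves as the slack, as the smallness condition that
    excludes breakdown, and as the bound on the error of [L L^*], the first and the last in units of
    [lam]. The matrices met by the algorithm need not be Hermitian. Their positivity and
    invertibility come from coercivity of the real part of the form; symmetry is used for the
    reference matrices only. *)

Section ComplexNorm.
Variable R : realType.
Implicit Types z w : R[i].

Lemma normc_ge0 z : 0 <= normc z.
Proof. by case: z => a b; exact: sqrtr_ge0. Qed.

Lemma normrE z : `|z| = (normc z)%:C.
Proof. by case: z. Qed.

Lemma normcD z w : normc (z + w) <= normc z + normc w.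
Proof. by rewrite -lecR rmorphD -!normrE ler_normD. Qed.

Lemma normcN z : normc (- z) = normc z.
Proof. by apply: complexI; rewrite -!normrE normrN. Qed.

Lemma normc_sum (I : finType) (F : I -> R[i]) :
  normc (\sum_i F i) <= \sum_i normc (F i).
Proof.
rewrite -lecR rmorph_sum -normrE (le_trans (ler_norm_sum _ _ _))//.
Qed.

Lemma normc_sqr z : normc z ^+ 2 = Re z ^+ 2 + Im z ^+ 2.
Proof. by case: z => a b /=; rewrite sqr_sqrtr// addr_ge0 ?sqr_ge0. Qed.

Lemma normc_conj z : normc z^* = normc z.
Proof. by case: z => a b /=; rewrite sqrrN. Qed.

Lemma normc_real (a : R) : normc a%:C = `|a|.
Proof. by rewrite /= expr0n addr0 sqrtr_sqr. Qed.

Lemma Im_le_normc z : `|Im z| <= normc z.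
Proof.
rewrite -(@ler_pXn2r _ 2) ?nnegrE ?normc_ge0// normc_sqr.
by rewrite real_normK ?num_real// lerDr sqr_ge0.
Qed.

Lemma ReD z w : Re (z + w) = Re z + Re w.
Proof. by case: z w => a b []. Qed.

Lemma Re_sum (I : finType) (F : I -> R[i]) : Re (\sum_i F i) = \sum_i Re (F i).
Proof. exact: (big_morph (@Re R) ReD). Qed.

Lemma conjCE z : Num.conj z = z^*.
Proof. by []. Qed.

End ComplexNorm.

(** * Real inner product and Euclidean norm of complex vectors *)

Section RealInnerProduct.
Variable R : realType.
Implicit Type n : nat.

(** This is the Euclidean product of the underlying real space of dimension [2n]. It is symmetric
    and real bilinear, and [posdefmx] speaks of exactly this form, so non-Hermitian matrices need no
    separate treatment. *)
Definition ip n (x y : 'cV[R[i]]_n) : R := Re ((x ^t* *m y) 0 0).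

Lemma ipE n (x y : 'cV[R[i]]_n) :
  ip x y = \sum_i (Re (x i 0) * Re (y i 0) + Im (x i 0) * Im (y i 0)).
Proof.
rewrite /ip mxE Re_sum; apply: eq_bigr => i _; rewrite !mxE conjCE.
by case: (x i 0) (y i 0) => a b [c d] /=; rewrite mulNr opprK.
Qed.

Lemma ipC n (x y : 'cV[R[i]]_n) : ip x y = ip y x.
Proof. by rewrite !ipE; apply: eq_bigr => i _; rewrite mulrC (mulrC (Im _)). Qed.

Lemma ipDr n (x y z : 'cV[R[i]]_n) : ip x (y + z) = ip x y + ip x z.
Proof. by rewrite /ip mulmxDr mxE ReD. Qed.

Lemma ipDl n (x y z : 'cV[R[i]]_n) : ip (y + z) x = ip y x + ip z x.
Proof. by rewrite ipC ipDr !(ipC x). Qed.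

Lemma ipZr n (t : R) (x y : 'cV[R[i]]_n) : ip x (t%:C *: y) = t * ip x y.
Proof.
rewrite /ip -scalemxAr mxE; case: (_ 0 0) => a b /=.
by rewrite mul0r subr0.
Qed.

Lemma ipZl n (t : R) (x y : 'cV[R[i]]_n) : ip (t%:C *: x) y = t * ip x y.
Proof. by rewrite ipC ipZr ipC. Qed.

Lemma ipNr n (x y : 'cV[R[i]]_n) : ip x (- y) = - ip x y.
Proof. by rewrite -[- y]scaleN1r -[RHS]mulN1r -ipZr rmorphN1. Qed.

Lemma ipNl n (x y : 'cV[R[i]]_n) : ip (- x) y = - ip x y.
Proof. by rewrite ipC ipNr ipC. Qed.

Lemma ip_adj n (A : 'M[R[i]]_n) (x y : 'cV[R[i]]_n) :
  ip x (A *m y) = ip (A ^t* *m x) y.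
Proof. by rewrite /ip trmx_mul map_mxM trmxCK mulmxA. Qed.

Lemma vnorm_ge0 n (x : 'cV[R[i]]_n) : 0 <= vnorm x.
Proof. exact: sqrtr_ge0. Qed.

Lemma vnorm_sqrE n (x : 'cV[R[i]]_n) : vnorm x ^+ 2 = \sum_i normc (x i 0) ^+ 2.
Proof. by rewrite sqr_sqrtr// sumr_ge0// => i _; rewrite sqr_ge0. Qed.

Lemma vnorm_sqr n (x : 'cV[R[i]]_n) : vnorm x ^+ 2 = ip x x.
Proof.
by rewrite vnorm_sqrE ipE; apply: eq_bigr => i _; rewrite normc_sqr !expr2.
Qed.

Lemma normc_le_vnorm n (x : 'cV[R[i]]_n) i : normc (x i 0) <= vnorm x.
Proof.
rewrite -(@ler_pXn2r _ 2) ?nnegrE ?normc_ge0 ?vnorm_ge0// vnorm_sqrE.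
by rewrite (bigD1 i)//= lerDl sumr_ge0// => j _; rewrite sqr_ge0.
Qed.

Lemma vnorm0 n : vnorm (0 : 'cV[R[i]]_n) = 0.
Proof. by rewrite /vnorm big1 ?sqrtr0// => i _; rewrite mxE normc0 expr0n. Qed.

Lemma vnorm_eq0 n (x : 'cV[R[i]]_n) : vnorm x = 0 -> x = 0.
Proof.
move=> x0; apply/colP => i; rewrite mxE; apply: eq0_normc.
by apply/eqP; rewrite eq_le normc_ge0 -x0 normc_le_vnorm.
Qed.

Lemma vnorm_gt0 n (x : 'cV[R[i]]_n) : x != 0 -> 0 < vnorm x.
Proof.
by move=> x0; rewrite lt_def vnorm_ge0 andbT; apply: contra_neq x0 => /vnorm_eq0.
Qed.

(** Cauchy-Schwarz: the squared norm of [|y| x - |x| y] equals [2 |x| |y| (|x| |y| - ip x y)], and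
    the first factor can be cancelled. *)
Lemma ip_le_vnorm n (x y : 'cV[R[i]]_n) : ip x y <= vnorm x * vnorm y.
Proof.
have [->|/vnorm_gt0 x0] := eqVneq x 0.
  by rewrite -(scale0r 0) ipZl mul0r mulr_ge0 ?vnorm_ge0.
have [->|/vnorm_gt0 y0] := eqVneq y 0.
  by rewrite -(scale0r 0) ipZr mul0r mulr_ge0 ?vnorm_ge0.
have := sqr_ge0 (vnorm ((vnorm y)%:C *: x - (vnorm x)%:C *: y)).
rewrite vnorm_sqr ipDl !ipDr !ipNl !ipNr !ipZl !ipZr (ipC y x) -!vnorm_sqr.
set a := vnorm x in x0 *; set b := vnorm y in y0 *; set c := ip x y.
have -> : b * (b * a ^+ 2) + - (b * (a * c)) +
   (- (a * (b * c)) - - (a * (a * b ^+ 2))) = (2 * (a * b)) * (a * b - c) by ring.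
by rewrite pmulr_rge0 ?subr_ge0// !mulr_gt0.
Qed.

Lemma vnormD n (x y : 'cV[R[i]]_n) : vnorm (x + y) <= vnorm x + vnorm y.
Proof.
rewrite -(@ler_pXn2r _ 2) ?nnegrE ?addr_ge0 ?vnorm_ge0//.
rewrite vnorm_sqr ipDl !ipDr (ipC y x) -!vnorm_sqr.
have := ip_le_vnorm x y; lra.
Qed.

Lemma vnormZ n (c : R[i]) (x : 'cV[R[i]]_n) : vnorm (c *: x) = normc c * vnorm x.
Proof.
apply/eqP; rewrite -(@eqrXn2 _ 2) ?mulr_ge0 ?vnorm_ge0 ?normc_ge0// exprMn.
rewrite !vnorm_sqrE mulr_sumr; apply/eqP/eq_bigr => i _.
by rewrite mxE normcM exprMn.
Qed.

Lemma vnormN n (x : 'cV[R[i]]_n) : vnorm (- x) = vnorm x.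
Proof. by rewrite -scaleN1r vnormZ normcN normc1 mul1r. Qed.

Lemma vnorm_le_sum n (x : 'cV[R[i]]_n) : vnorm x <= \sum_i normc (x i 0).
Proof.
have s0 : 0 <= \sum_i normc (x i 0) by rewrite sumr_ge0// => i _; exact: normc_ge0.
rewrite -(@ler_pXn2r _ 2) ?nnegrE ?vnorm_ge0// vnorm_sqrE expr2 mulr_suml.
apply: ler_sum => i _; rewrite expr2 ler_wpM2l ?normc_ge0//.
by rewrite (bigD1 i)//= lerDl sumr_ge0// => j _; exact: normc_ge0.
Qed.

Lemma vnorm_col_mx p q (x : 'cV[R[i]]_p) (y : 'cV[R[i]]_q) :
  vnorm (col_mx x y) ^+ 2 = vnorm x ^+ 2 + vnorm y ^+ 2.
Proof.
rewrite !vnorm_sqrE big_split_ord/=; congr (_ + _); apply: eq_bigr => i _.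
  by rewrite col_mxEu.
by rewrite col_mxEd.
Qed.

End RealInnerProduct.

(** * The spectral norm *)

Section SpectralNorm.
Variable R : realType.
Implicit Type n : nat.

(** The factor [n^2] is crude, but it is never compounded over the levels of the recursion. *)
Lemma vnorm_mul_entries n (A : 'M[R[i]]_n) (c : R) (x : 'cV[R[i]]_n) :
  (forall i j, normc (A i j) <= c) -> vnorm (A *m x) <= n%:R ^+ 2 * c * vnorm x.
Proof.
move=> Ac; apply: (le_trans (vnorm_le_sum _)).
have -> : n%:R ^+ 2 * c * vnorm x = \sum_(i < n) \sum_(j < n) c * vnorm x.
  by rewrite !sumr_const card_ord -mulrnA -[RHS]mulr_natl natrM; ring.
apply: ler_sum => i _; rewrite mxE (le_trans (normc_sum _))//.
apply: ler_sum => j _; rewrite normcM ler_pM ?normc_ge0//.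
exact: normc_le_vnorm.
Qed.

(** [sup] takes a default value on sets without a supremum, so every use of [specnorm] rests on
    this. The sum of all entries in modulus is a convenient common bound for the entries. *)
Lemma specnorm_has_sup n (A : 'M[R[i]]_n) :
  has_sup [set vnorm (A *m x) | x in [set x : 'cV[R[i]]_n | vnorm x <= 1]]%classic.
Proof.
split; first by exists (vnorm (A *m 0)), 0 => //=; rewrite vnorm0 ler01.
pose c := \sum_i \sum_j normc (A i j).
have Ac i j : normc (A i j) <= c.
  rewrite /c (bigD1 i)//= (bigD1 j)//= -addrA lerDl addr_ge0// sumr_ge0// => k _.
    exact: normc_ge0.
  by apply: sumr_ge0 => l _; exact: normc_ge0.
exists (n%:R ^+ 2 * c) => _ [x /= x1 <-].
apply: (le_trans (vnorm_mul_entries x Ac)).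
rewrite ler_piMr// mulr_ge0 ?sqr_ge0// sumr_ge0// => i _.
by apply: sumr_ge0 => j _; exact: normc_ge0.
Qed.

Lemma vnorm_mul_le n (A : 'M[R[i]]_n) (x : 'cV[R[i]]_n) :
  vnorm (A *m x) <= specnorm A * vnorm x.
Proof.
have [->|/vnorm_gt0 x0] := eqVneq x 0; first by rewrite mulmx0 !vnorm0 mulr0.
have x1 : vnorm ((vnorm x)^-1%:C *: x) <= 1.
  by rewrite vnormZ normc_real ger0_norm ?invr_ge0 ?vnorm_ge0// mulVf ?gt_eqF.
rewrite -ler_pdivrMr// mulrC -[X in X * _]ger0_norm ?invr_ge0 ?vnorm_ge0//.
rewrite -normc_real -vnormZ scalemxAr.
by apply: (ub_le_sup (specnorm_has_sup A).2); exists ((vnorm x)^-1%:C *: x).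
Qed.

Lemma specnorm_le n (A : 'M[R[i]]_n) (c : R) : 0 <= c ->
  (forall x, vnorm (A *m x) <= c * vnorm x) -> specnorm A <= c.
Proof.
move=> c0 Ac; apply: ge_sup; first exact: (specnorm_has_sup A).1.
by move=> _ [x /= x1 <-]; rewrite (le_trans (Ac x))// ler_piMr.
Qed.

Lemma specnorm_ge0 n (A : 'M[R[i]]_n) : 0 <= specnorm A.
Proof.
apply: (ub_le_sup (specnorm_has_sup A).2); exists 0 => /=.
  by rewrite vnorm0 ler01.
by rewrite mulmx0 vnorm0.
Qed.

Lemma specnormD n (A B : 'M[R[i]]_n) : specnorm (A + B) <= specnorm A + specnorm B.
Proof.
apply: specnorm_le => [|x]; first by rewrite addr_ge0 ?specnorm_ge0.
by rewrite mulmxDl mulrDl (le_trans (vnormD _ _))// lerD ?vnorm_mul_le.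
Qed.

Lemma specnormN n (A : 'M[R[i]]_n) : specnorm (- A) = specnorm A.
Proof.
have aux (B : 'M[R[i]]_n) : specnorm (- B) <= specnorm B.
  apply: specnorm_le => [|x]; first exact: specnorm_ge0.
  by rewrite mulNmx vnormN vnorm_mul_le.
by apply/eqP; rewrite eq_le aux -{1}[A]opprK aux.
Qed.

Lemma specnormM n (A B : 'M[R[i]]_n) : specnorm (A *m B) <= specnorm A * specnorm B.
Proof.
apply: specnorm_le => [|x]; first by rewrite mulr_ge0 ?specnorm_ge0.
rewrite -mulmxA (le_trans (vnorm_mul_le _ _))// -mulrA.
by rewrite ler_wpM2l ?specnorm_ge0 ?vnorm_mul_le.
Qed.

(** Cauchy-Schwarz applied to [|A x|^2 = ip (A^* A x) x]. It yields the invariance of the norm under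
    adjoints, and later a bound on a computed factor [L11] from the size of [L11 L11^*]. *)
Lemma specnorm_adj_mul n (A : 'M[R[i]]_n) :
  specnorm A ^+ 2 <= specnorm (A ^t* *m A).
Proof.
set c := specnorm (A ^t* *m A).
have c0 : 0 <= c := specnorm_ge0 _.
rewrite -[leRHS]sqr_sqrtr// ler_pXn2r ?nnegrE ?sqrtr_ge0 ?specnorm_ge0//.
apply: specnorm_le => [|x]; first exact: sqrtr_ge0.
rewrite -(@ler_pXn2r _ 2) ?nnegrE ?mulr_ge0 ?sqrtr_ge0 ?vnorm_ge0//.
rewrite exprMn [Num.sqrt c ^+ 2]sqr_sqrtr// [leLHS]vnorm_sqr ip_adj ipC.
rewrite (le_trans (ip_le_vnorm _ _))//.
by rewrite mulmxA expr2 mulrCA ler_wpM2l ?vnorm_ge0// vnorm_mul_le.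
Qed.

Lemma specnorm_adj_le n (A : 'M[R[i]]_n) : specnorm (A ^t*) <= specnorm A.
Proof.
have [->|A0] := eqVneq (specnorm (A ^t*)) 0; first exact: specnorm_ge0.
rewrite -(@ler_pM2r _ (specnorm (A ^t*))) ?lt_def ?A0 ?specnorm_ge0//.
by rewrite -expr2 (le_trans (specnorm_adj_mul _))// trmxCK specnormM.
Qed.

Lemma specnorm_adj n (A : 'M[R[i]]_n) : specnorm (A ^t*) = specnorm A.
Proof.
by apply/eqP; rewrite eq_le specnorm_adj_le -{1}[A]trmxCK specnorm_adj_le.
Qed.

Lemma specnorm_mul_adj n (A : 'M[R[i]]_n) : specnorm A ^+ 2 <= specnorm (A *m A ^t*).
Proof. by have := specnorm_adj_mul (A ^t*); rewrite trmxCK specnorm_adj. Qed.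

Lemma specnorm_entries n (A : 'M[R[i]]_n) (c : R) : 0 <= c ->
  (forall i j, normc (A i j) <= c) -> specnorm A <= n%:R ^+ 2 * c.
Proof.
move=> c0 Ac; apply: specnorm_le => [|x]; first by rewrite mulr_ge0 ?sqr_ge0.
exact: vnorm_mul_entries.
Qed.

Lemma normc_le_specnorm n (A : 'M[R[i]]_n) i j : normc (A i j) <= specnorm A.
Proof.
have := vnorm_mul_le A (delta_mx j 0); rewrite -colE.
have -> : vnorm (delta_mx j 0 : 'cV[R[i]]_n) = 1.
  rewrite /vnorm (bigD1 j)//= big1 ?addr0; last first.
    by move=> k /negPf kj; rewrite mxE kj normc0 expr0n.
  by rewrite mxE !eqxx normc1 expr1n sqrtr1.
rewrite mulr1; apply: le_trans.
by have := normc_le_vnorm (col j A) i; rewrite mxE.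
Qed.

(** Unlike [specnorm_entries], no dimension factor: this keeps the error on the diagonal of [HERM]
    from growing with [n] at each level. *)
Lemma specnorm_diag n (A : 'M[R[i]]_n) (c : R) : 0 <= c -> is_diag_mx A ->
  (forall i, normc (A i i) <= c) -> specnorm A <= c.
Proof.
move=> c0 /is_diag_mxP dA Ac; apply: specnorm_le => // x.
rewrite -(@ler_pXn2r _ 2) ?nnegrE ?mulr_ge0 ?vnorm_ge0// exprMn !vnorm_sqrE.
rewrite mulr_sumr; apply: ler_sum => i _.
rewrite mxE (bigD1 i)//= big1 ?addr0; last first.
  by move=> j ji; rewrite dA ?mul0r// eq_sym.
by rewrite normcM exprMn ler_wpM2r ?sqr_ge0// ler_pXn2r ?nnegrE ?normc_ge0.
Qed.

Lemma specnorm1 n : (0 < n)%N -> specnorm (1%:M : 'M[R[i]]_n) = 1.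
Proof.
case: n => // n _; apply/eqP; rewrite eq_le; apply/andP; split.
  by apply: specnorm_le => // x; rewrite mul1mx mul1r.
have := normc_le_specnorm (1%:M : 'M[R[i]]_n.+1) 0 0.
by rewrite mxE eqxx normc1.
Qed.

End SpectralNorm.

(** * Norm estimates for sums, products and adjoints *)

Section SpectralNormBounds.
Variable R : realType.
Implicit Type n : nat.

Lemma specnormD_le n (A B : 'M[R[i]]_n) (a b : R) :
  specnorm A <= a -> specnorm B <= b -> specnorm (A + B) <= a + b.
Proof. by move=> Aa Bb; rewrite (le_trans (specnormD _ _))// lerD. Qed.

Lemma specnormM_le n (A B : 'M[R[i]]_n) (a b : R) :
  specnorm A <= a -> specnorm B <= b -> specnorm (A *m B) <= a * b.
Proof.
by move=> Aa Bb; rewrite (le_trans (specnormM _ _))// ler_pM ?specnorm_ge0.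
Qed.

Lemma specnorm_distC n (A B : 'M[R[i]]_n) : specnorm (A - B) = specnorm (B - A).
Proof. by rewrite -specnormN opprB. Qed.

Lemma specnorm_near n (A B : 'M[R[i]]_n) (a b : R) :
  specnorm (A - B) <= a -> specnorm B <= b -> specnorm A <= a + b.
Proof. by move=> Aa Bb; rewrite -[A](subrK B) specnormD_le. Qed.

Lemma specnorm_trans n (A B C : 'M[R[i]]_n) (a b : R) :
  specnorm (A - B) <= a -> specnorm (B - C) <= b -> specnorm (A - C) <= a + b.
Proof. by move=> Aa Bb; rewrite -[A](subrK B) -addrA specnormD_le. Qed.

Lemma specnorm_distM n (A A' B B' : 'M[R[i]]_n) (a b a' b' : R) :
  specnorm (A - A') <= a -> specnorm B <= b ->
  specnorm A' <= a' -> specnorm (B - B') <= b' ->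
  specnorm (A *m B - A' *m B') <= a * b + a' * b'.
Proof.
move=> Aa Bb A'a B'b.
have -> : A *m B - A' *m B' = (A - A') *m B + A' *m (B - B').
  by rewrite mulmxBl mulmxBr addrA subrK.
by apply: specnormD_le; apply: specnormM_le.
Qed.

Lemma specnorm_dist_adj n (A B : 'M[R[i]]_n) :
  specnorm (A ^t* - B ^t*) = specnorm (A - B).
Proof. by rewrite -[RHS]specnorm_adj linearB /= map_mxB. Qed.

Lemma adjM n (A B : 'M[R[i]]_n) : (A *m B) ^t* = B ^t* *m A ^t*.
Proof. by rewrite trmx_mul map_mxM. Qed.

Lemma adjB n (A B : 'M[R[i]]_n) : (A - B) ^t* = A ^t* - B ^t*.
Proof. by rewrite linearB /= map_mxB. Qed.

Lemma adjV n (A : 'M[R[i]]_n) : (invmx A) ^t* = invmx (A ^t*).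
Proof. by rewrite trmx_inv map_invmx. Qed.

Lemma hermsymmxE n (A : 'M[R[i]]_n) : A \is hermsymmx -> A ^t* = A.
Proof. by move=> /is_hermitianmxP {2}->; rewrite expr0 scale1r. Qed.

End SpectralNormBounds.

(** * Quadratic forms, coercivity and inverses *)

Section QuadraticForm.
Variable R : realType.
Implicit Type n : nat.

Lemma norm_ip_mul_le n (A : 'M[R[i]]_n) (a : R) (x : 'cV[R[i]]_n) :
  specnorm A <= a -> `|ip x (A *m x)| <= a * vnorm x ^+ 2.
Proof.
move=> Aa; have Ax : vnorm (A *m x) <= a * vnorm x.
  by rewrite (le_trans (vnorm_mul_le _ _))// ler_wpM2r ?vnorm_ge0.
have aux y : vnorm y <= a * vnorm x -> ip x y <= a * vnorm x ^+ 2.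
  move=> yx; rewrite (le_trans (ip_le_vnorm _ _))// expr2 mulrCA.
  by rewrite ler_wpM2l ?vnorm_ge0.
rewrite ler_norml aux// andbT lerNl -ipNr aux//.
by rewrite vnormN.
Qed.

Lemma ip_near_ge n (A B : 'M[R[i]]_n) (a l : R) (x : 'cV[R[i]]_n) :
  specnorm (A - B) <= a -> l * vnorm x ^+ 2 <= ip x (B *m x) ->
  (l - a) * vnorm x ^+ 2 <= ip x (A *m x).
Proof.
move=> AB Bx; have := norm_ip_mul_le x AB; rewrite ler_norml => /andP[+ _].
rewrite mulmxBl ipDr ipNr; lra.
Qed.

Lemma ip_near_le n (A B : 'M[R[i]]_n) (a l : R) (x : 'cV[R[i]]_n) :
  specnorm (A - B) <= a -> ip x (B *m x) <= l * vnorm x ^+ 2 ->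
  ip x (A *m x) <= (l + a) * vnorm x ^+ 2.
Proof.
move=> AB Bx; have := norm_ip_mul_le x AB; rewrite ler_norml => /andP[_].
rewrite mulmxBl ipDr ipNr; lra.
Qed.

(* Evaluate the form at [x - M x / N]. *)
Lemma psd_vnorm_mul_sqr n (M : 'M[R[i]]_n) (N : R) (x : 'cV[R[i]]_n) : 0 < N ->
  M ^t* = M -> (forall y, 0 <= ip y (M *m y) <= N * vnorm y ^+ 2) ->
  vnorm (M *m x) ^+ 2 <= N * ip x (M *m x).
Proof.
move=> N0 hM MN; have /andP[+ _] := MN (x - N^-1%:C *: (M *m x)).
rewrite mulmxBr -scalemxAr ipDl !ipDr !ipNl !ipNr !ipZl !ipZr.
rewrite (ip_adj M x (M *m x)) hM -vnorm_sqr.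
have /andP[_ ] := MN (M *m x).
set a := ip _ (M *m (M *m x)); set b := vnorm _ ^+ 2; set c := ip x _ => aN h.
have : 0 <= N ^+ 2 * (c + - (N^-1 * b) + (- (N^-1 * b) - - (N^-1 * (N^-1 * a)))).
  by rewrite mulr_ge0 ?sqr_ge0.
have -> : N ^+ 2 * (c + - (N^-1 * b) + (- (N^-1 * b) - - (N^-1 * (N^-1 * a)))) =
    N ^+ 2 * c - 2 * N * b + a by field; rewrite gt_eqF.
move=> {}h; have {}h : 0 <= N * (N * c - b) by lra.
by rewrite pmulr_rge0 ?subr_ge0 in h.
Qed.

(** Chaining [|M y|^2 <= N * ip y (M y)] with the bound on the form replaces an appeal to the
    spectral theorem. *)
Lemma psd_specnorm_le n (M : 'M[R[i]]_n) (N : R) : 0 < N ->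
  M ^t* = M -> (forall y, 0 <= ip y (M *m y) <= N * vnorm y ^+ 2) ->
  specnorm M <= N.
Proof.
move=> N0 hM MN; apply: specnorm_le => [|x]; first exact: ltW.
rewrite -(@ler_pXn2r _ 2) ?nnegrE ?mulr_ge0 ?vnorm_ge0 ?(ltW N0)//.
rewrite (le_trans (psd_vnorm_mul_sqr x N0 hM MN))// exprMn expr2 -mulrA.
by rewrite ler_wpM2l ?(ltW N0)//; have /andP[] := MN x.
Qed.

Lemma injective_unitmx n (A : 'M[R[i]]_n) :
  (forall x : 'cV_n, A *m x = 0 -> x = 0) -> A \in unitmx.
Proof.
move=> injA; rewrite -unitmx_tr -row_free_unit; apply: inj_row_free => v vA.
apply: trmx_inj; rewrite trmx0; apply: injA; apply: trmx_inj.
by rewrite trmx_mul trmxK vA trmx0.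
Qed.

(** Finite-dimensional Lax-Milgram: Cauchy-Schwarz turns coercivity into [l |x| <= |A x|]. Symmetry
    is not assumed, since the result is applied to blocks perturbed by rounding. *)
Lemma coercive_unitmx n (A : 'M[R[i]]_n) (l : R) : 0 < l ->
  (forall x, l * vnorm x ^+ 2 <= ip x (A *m x)) ->
  A \in unitmx /\ specnorm (invmx A) <= l^-1.
Proof.
move=> l0 Al.
have lA x : l * vnorm x <= vnorm (A *m x).
  have [->|/vnorm_gt0 x0] := eqVneq x 0; first by rewrite vnorm0 mulr0 vnorm_ge0.
  rewrite -(ler_pM2l x0) mulrCA -expr2 (le_trans (Al x))//.
  exact: ip_le_vnorm.
have uA : A \in unitmx.
  apply: injective_unitmx => x Ax; apply: vnorm_eq0.
  have := lA x; rewrite Ax vnorm0 pmulr_rle0// => v0.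
  by apply/eqP; rewrite eq_le v0 vnorm_ge0.
split=> //; apply: specnorm_le => [|y]; first by rewrite invr_ge0 ltW.
by have := lA (invmx A *m y); rewrite mulKVmx// ler_pdivlMl.
Qed.

Lemma posdefmx_coercive n (A : 'M[R[i]]_n) (l : R) : 0 < l ->
  (forall x, l * vnorm x ^+ 2 <= ip x (A *m x)) -> posdefmx A.
Proof.
move=> l0 Al x /vnorm_gt0 x0; rewrite -mulmxA.
by apply: lt_le_trans (Al x); rewrite mulr_gt0// exprn_gt0.
Qed.

Lemma specnorm_invmx_dist n (A B : 'M[R[i]]_n) (a b c : R) :
  A \in unitmx -> B \in unitmx -> specnorm (invmx A) <= a ->
  specnorm (invmx B) <= b -> specnorm (A - B) <= c ->
  specnorm (invmx A - invmx B) <= a * c * b.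
Proof.
move=> uA uB Aa Bb AB.
have -> : invmx A - invmx B = invmx A *m (B - A) *m invmx B.
  by rewrite mulmxBr mulmxBl mulVmx// mul1mx -mulmxA mulmxV// mulmx1.
by apply: specnormM_le Bb; apply: specnormM_le Aa _; rewrite specnorm_distC.
Qed.

End QuadraticForm.

(** * Two by two block matrices *)

Section Blocks.
Variables (R : realType) (p : nat).
Implicit Types M : 'M[R[i]]_(p + p).

Lemma vnorm_usubmx (x : 'cV[R[i]]_(p + p)) : vnorm (usubmx x) <= vnorm x.
Proof.
rewrite -(@ler_pXn2r _ 2) ?nnegrE ?vnorm_ge0// -{2}[x]vsubmxK vnorm_col_mx.
by rewrite lerDl sqr_ge0.
Qed.

Lemma vnorm_dsubmx (x : 'cV[R[i]]_(p + p)) : vnorm (dsubmx x) <= vnorm x.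
Proof.
rewrite -(@ler_pXn2r _ 2) ?nnegrE ?vnorm_ge0// -{2}[x]vsubmxK vnorm_col_mx.
by rewrite lerDr sqr_ge0.
Qed.

Lemma vnorm_col_mx0 (x : 'cV[R[i]]_p) : vnorm (col_mx x (0 : 'cV[R[i]]_p)) = vnorm x.
Proof.
apply/eqP; rewrite -(@eqrXn2 _ 2) ?vnorm_ge0// vnorm_col_mx vnorm0.
by rewrite expr0n addr0.
Qed.

Lemma vnorm_col_0mx (x : 'cV[R[i]]_p) : vnorm (col_mx (0 : 'cV[R[i]]_p) x) = vnorm x.
Proof.
apply/eqP; rewrite -(@eqrXn2 _ 2) ?vnorm_ge0// vnorm_col_mx vnorm0.
by rewrite expr0n add0r.
Qed.

Lemma ip_col_mx (x y z t : 'cV[R[i]]_p) :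
  ip (col_mx x y) (col_mx z t) = ip x z + ip y t.
Proof. by rewrite /ip tr_col_mx map_row_mx mul_row_col mxE ReD. Qed.

Lemma mul_mx_col M (x y : 'cV[R[i]]_p) :
  M *m col_mx x y = col_mx (ulsubmx M *m x + ursubmx M *m y)
                           (dlsubmx M *m x + drsubmx M *m y).
Proof. by rewrite -{1}[M]submxK mul_block_col. Qed.

Lemma specnorm_ulsubmx M : specnorm (ulsubmx M) <= specnorm M.
Proof.
apply: specnorm_le => [|x]; first exact: specnorm_ge0.
have := vnorm_mul_le M (col_mx x 0); rewrite vnorm_col_mx0; apply: le_trans.
have -> : ulsubmx M *m x = usubmx (M *m col_mx x 0).
  by rewrite mul_mx_col col_mxKu mulmx0 addr0.
exact: vnorm_usubmx.
Qed.

Lemma specnorm_dlsubmx M : specnorm (dlsubmx M) <= specnorm M.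
Proof.
apply: specnorm_le => [|x]; first exact: specnorm_ge0.
have := vnorm_mul_le M (col_mx x 0); rewrite vnorm_col_mx0; apply: le_trans.
have -> : dlsubmx M *m x = dsubmx (M *m col_mx x 0).
  by rewrite mul_mx_col col_mxKd mulmx0 addr0.
exact: vnorm_dsubmx.
Qed.

Lemma specnorm_drsubmx M : specnorm (drsubmx M) <= specnorm M.
Proof.
apply: specnorm_le => [|x]; first exact: specnorm_ge0.
have := vnorm_mul_le M (col_mx 0 x); rewrite vnorm_col_0mx; apply: le_trans.
have -> : drsubmx M *m x = dsubmx (M *m col_mx 0 x).
  by rewrite mul_mx_col col_mxKd mulmx0 add0r.
exact: vnorm_dsubmx.
Qed.

Lemma vnorm_col_mx_le (x y : 'cV[R[i]]_p) : vnorm (col_mx x y) <= vnorm x + vnorm y.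
Proof.
have -> : col_mx x y = col_mx x 0 + col_mx 0 y by rewrite add_col_mx addr0 add0r.
by rewrite (le_trans (vnormD _ _))// vnorm_col_mx0 vnorm_col_0mx.
Qed.

(** Adding the four bounds is wasteful, but the loss is a constant per level and only enlarges
    [E]. *)
Lemma specnorm_block_mx (A B C D : 'M[R[i]]_p) (a b c d : R) :
  specnorm A <= a -> specnorm B <= b -> specnorm C <= c -> specnorm D <= d ->
  specnorm (block_mx A B C D) <= a + b + (c + d).
Proof.
move=> Aa Bb Cc Dd.
have [a0 b0 c0 d0] : [/\ 0 <= a, 0 <= b, 0 <= c & 0 <= d].
  by split; [move: Aa|move: Bb|move: Cc|move: Dd]; apply: le_trans;
    exact: specnorm_ge0.
have aux (X : 'M[R[i]]_p) (e : R) (y : 'cV[R[i]]_p) (x : 'cV[R[i]]_(p + p)) :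
    specnorm X <= e -> vnorm y <= vnorm x -> vnorm (X *m y) <= e * vnorm x.
  move=> Xe yx; rewrite (le_trans (vnorm_mul_le _ _))//.
  by rewrite ler_pM ?specnorm_ge0 ?vnorm_ge0.
apply: specnorm_le => [|x]; first by rewrite !addr_ge0.
rewrite -{1}[x]vsubmxK mul_block_col (le_trans (vnorm_col_mx_le _ _))// mulrDl.
rewrite lerD// (le_trans (vnormD _ _))// mulrDl lerD// aux//.
- exact: vnorm_usubmx.
- exact: vnorm_dsubmx.
- exact: vnorm_usubmx.
- exact: vnorm_dsubmx.
Qed.

Lemma adj_block_mx (A B C D : 'M[R[i]]_p) :
  (block_mx A B C D) ^t* = block_mx (A ^t*) (C ^t*) (B ^t*) (D ^t*).
Proof. by rewrite tr_block_mx map_block_mx. Qed.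

End Blocks.

(** * Schur complements under two-sided bounds on the form *)

Section SchurComplement.
Variables (R : realType) (p : nat) (M : 'M[R[i]]_(p + p)) (l N : R).
Hypotheses (l0 : 0 < l) (hM : M ^t* = M).
Hypothesis lM : forall x, l * vnorm x ^+ 2 <= ip x (M *m x).
Hypothesis MN : forall x, ip x (M *m x) <= N * vnorm x ^+ 2.

Let A := ulsubmx M.
Let B := dlsubmx M.
Let C := drsubmx M.
Let S := C - B *m invmx A *m B ^t*.

Lemma herm_blocks : [/\ A ^t* = A, B ^t* = ursubmx M & C ^t* = C].
Proof.
have : (block_mx A (ursubmx M) B C) ^t* = block_mx A (ursubmx M) B C.
  by rewrite submxK.
by rewrite adj_block_mx => /eq_block_mx[].
Qed.

Lemma ulsubmx_form x : l * vnorm x ^+ 2 <= ip x (A *m x) <= N * vnorm x ^+ 2.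
Proof.
have := lM (col_mx x 0); have := MN (col_mx x 0).
rewrite mul_mx_col ip_col_mx vnorm_col_mx0 !mulmx0 !addr0.
by rewrite (ipC 0) -(scale0r 0) ipZr mul0r addr0 => -> ->.
Qed.

Lemma schur_adj : (B *m invmx A *m B ^t*) ^t* = B *m invmx A *m B ^t*.
Proof.
by have [hA _ _] := herm_blocks; rewrite !adjM trmxCK adjV hA mulmxA.
Qed.

(* The form of the Schur complement at [x] is the form of [M] at
   [(- A^-1 B^* x, x)]. *)
Lemma schur_form x : l * vnorm x ^+ 2 <= ip x (S *m x) <= N * vnorm x ^+ 2.
Proof.
have [hA hB _] := herm_blocks.
have [uA _] := coercive_unitmx l0 (fun x => (andP (ulsubmx_form x)).1).
pose y := invmx A *m (B ^t* *m x).
have Ay : A *m y = B ^t* *m x by rewrite mulKVmx.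
have Sx : S *m x = C *m x - B *m y by rewrite mulmxBl -!mulmxA.
apply/andP; split.
  have := lM (col_mx (- y) x); rewrite vnorm_col_mx mul_mx_col -/A -/B -/C -hB.
  rewrite !mulmxN Ay addNr [- _ + _]addrC -Sx ip_col_mx.
  rewrite -(scale0r (0 : 'cV[R[i]]_p)) ipZr mul0r add0r; apply: le_trans.
  by rewrite ler_pM2l// lerDr sqr_ge0.
(* For the upper bound [C] suffices: the subtracted term is [ip y (A y) >= 0]. *)
have := MN (col_mx 0 x); rewrite vnorm_col_0mx mul_mx_col ip_col_mx !mulmx0 !add0r.
rewrite ipC -(scale0r (0 : 'cV[R[i]]_p)) ipZr mul0r add0r; apply: le_trans.
rewrite Sx ipDr ipNr gerBl ip_adj -Ay ipC (le_trans _ (andP (ulsubmx_form y)).1)//.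
by rewrite mulr_ge0 ?sqr_ge0// ltW.
Qed.

End SchurComplement.

(** * Symmetrization from the upper triangle *)

Section HermitianPart.
Variables (R : realType) (n : nat).
Implicit Types X Y : 'M[R[i]]_n.

(* [HERM X] itself is Hermitian only when the diagonal of [X] is real. *)
Definition HERMre X : 'M[R[i]]_n :=
  \matrix_(i, j) if i == j then (Re (X i i))%:C else HERM X i j.

Lemma HERMre_adj X : (HERMre X) ^t* = HERMre X.
Proof.
apply/matrixP => i j; rewrite !mxE conjCE; have [->|ij] := eqVneq i j.
  by rewrite /= oppr0.
have [_|//|/val_inj ijE] := ltngtP i j.
  by rewrite conjcK.
by rewrite ijE eqxx in ij.
Qed.

Lemma HERMre_fixed Y : Y ^t* = Y -> HERMre Y = Y.
Proof.
move=> hY; have Yij i j : (Y j i)^* = Y i j by rewrite -[in RHS]hY !mxE conjCE.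
apply/matrixP => i j; rewrite !mxE; have [<-|_] := eqVneq i j.
  have := Yij i i; case: (Y i i) => a b /= [] /eqP; rewrite eqr_oppLR -subr_eq0 opprK.
  by rewrite -mulr2n mulrn_eq0 /= => /eqP ->.
by case: ifP.
Qed.

Lemma HERMreB X Y : HERMre (X - Y) = HERMre X - HERMre Y.
Proof.
apply/matrixP => i j; rewrite !mxE; case: eqP => _.
  by case: (X i i) (Y i i) => a b [c d]; rewrite -rmorphB.
by case: ifP => // _; rewrite rmorphB.
Qed.

Lemma normc_HERM_le X i j : normc (HERM X i j) <= specnorm X.
Proof. by rewrite mxE; case: ifP => _; rewrite ?normc_conj normc_le_specnorm. Qed.

Lemma specnorm_HERMre X : specnorm (HERMre X) <= n%:R ^+ 2 * specnorm X.
Proof.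
apply: specnorm_entries => [|i j]; first exact: specnorm_ge0.
rewrite mxE; case: ifP => _; last exact: normc_HERM_le.
rewrite normc_real (le_trans _ (normc_le_specnorm X i i))//.
rewrite -(@ler_pXn2r _ 2) ?nnegrE ?normc_ge0// normc_sqr.
by rewrite real_normK ?num_real// lerDl sqr_ge0.
Qed.

(** The difference is diagonal with entries [i * Im (X i i)], and a Hermitian [Y] has a real
    diagonal, so these are also the imaginary parts of the diagonal of [X - Y]. *)
Lemma specnorm_HERM_HERMre X Y : Y ^t* = Y ->
  specnorm (HERM X - HERMre X) <= specnorm (X - Y).
Proof.
move=> hY; apply: specnorm_diag => [||i]; first exact: specnorm_ge0.
  by apply/is_diag_mxP => i j ij; rewrite !mxE (negPf (_ : i != j)) ?subrr.
rewrite !mxE eqxx ltnn.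
have Yi : Im (Y i i) = 0.
  by rewrite -(HERMre_fixed hY) mxE eqxx.
rewrite (le_trans _ (normc_le_specnorm (X - Y) i i))// !mxE.
apply: le_trans (Im_le_normc _).
move: Yi; case: (X i i) (Y i i) => a b [c d] /= ->.
by rewrite !subr0 subrr expr0n add0r sqrtr_sqr.
Qed.

End HermitianPart.

(** * Scalar inequalities behind one recursive step *)

Section StepArithmetic.
Variable R : realType.
Implicit Types lam kap theta w e s f g : R.

(** Each lemma of this section closes one norm estimate of the step below. It matters only that the
    numerical constants are absolute: their [k]-th powers are powers of [n]. *)
Lemma arith_near lam kap theta : 0 < lam -> 1 <= kap -> theta <= 4^-1 ->
  theta * lam + kap * lam <= 2 * kap * lam.
Proof. by move=> l0 k1 t4; rewrite -mulrDl ler_pM2r//; lra. Qed.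

Lemma arith_half lam theta : 0 < lam -> theta <= 4^-1 -> lam / 2 <= lam - theta * lam.
Proof.
move=> l0 t4; have : theta * lam <= 4^-1 * lam by rewrite ler_pM2r.
lra.
Qed.

Lemma arith_Z lam theta w : 0 < lam -> w <= theta ->
  w * (2 * lam^-1) + 2 * lam^-1 * (theta * lam) * lam^-1 <= 4 * theta * lam^-1.
Proof.
move=> l0 wt.
have -> : 2 * lam^-1 * (theta * lam) * lam^-1 = 2 * (theta * lam^-1).
  by field; rewrite gt_eqF.
have : w * lam^-1 <= theta * lam^-1 by rewrite ler_pM2r ?invr_gt0.
lra.
Qed.

Lemma arith_Z_norm lam theta : 0 < lam -> theta <= 4^-1 ->
  4 * theta * lam^-1 + lam^-1 <= 3 * lam^-1.
Proof.
move=> l0 t4; have l0' : 0 < lam^-1 by rewrite invr_gt0.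
have : theta * lam^-1 <= 4^-1 * lam^-1 by rewrite ler_pM2r.
lra.
Qed.

(** The product of the norms of [B] and [Z] is of order [kap], so a relative error [w] enters as
    [w * kap]; the hypothesis [w * kap <= theta] charges it to the inherited error. *)
Lemma arith_W lam kap theta w : 0 < lam -> 1 <= kap -> w * kap <= theta ->
  0 <= theta ->
  w * (2 * kap * lam) * (3 * lam^-1) +
  (theta * lam * (3 * lam^-1) + kap * lam * (4 * theta * lam^-1)) <=
  13 * kap * theta.
Proof.
move=> l0 k1 wk t0.
have -> : w * (2 * kap * lam) * (3 * lam^-1) +
  (theta * lam * (3 * lam^-1) + kap * lam * (4 * theta * lam^-1)) =
  6 * (w * kap) + 3 * theta + 4 * (kap * theta) by field; rewrite gt_eqF.
have : theta <= kap * theta by rewrite ler_peMl.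
lra.
Qed.

Lemma arith_W_norm kap theta : 1 <= kap -> theta <= 4^-1 ->
  13 * kap * theta + kap <= 8 * kap.
Proof.
move=> k1 t4.
have : kap * theta <= kap * 4^-1 by rewrite ler_wpM2l//; lra.
lra.
Qed.

Lemma arith_X lam kap theta w : 0 < lam -> 1 <= kap -> w * kap <= theta ->
  0 <= theta ->
  w * (8 * kap) * (2 * kap * lam) +
  (13 * kap * theta * (2 * kap * lam) + kap * (theta * lam)) <=
  50 * kap ^+ 2 * theta * lam.
Proof.
move=> l0 k1 wk t0.
have h1 : w * kap * (kap * lam) <= theta * (kap * lam).
  by rewrite ler_wpM2r// mulr_ge0 ?(ltW l0)//; lra.
have h2 : kap * (theta * lam) <= kap ^+ 2 * (theta * lam).
  by rewrite ler_wpM2r ?mulr_ge0 ?(ltW l0)// expr2 ler_peMl//; lra.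
have h3 : 0 <= kap ^+ 2 * (theta * lam).
  by rewrite mulr_ge0 ?sqr_ge0 ?mulr_ge0 ?(ltW l0).
lra.
Qed.

Lemma arith_X_norm lam kap theta : 0 < lam -> 1 <= kap -> theta <= 4^-1 ->
  50 * kap ^+ 2 * theta * lam + kap * (kap * lam) <= 14 * kap ^+ 2 * lam.
Proof.
move=> l0 k1 t4.
have h : kap ^+ 2 * lam * theta <= kap ^+ 2 * lam * 4^-1.
  by rewrite ler_wpM2l// mulr_ge0 ?sqr_ge0 ?(ltW l0).
have h3 : 0 <= kap ^+ 2 * lam.
  by rewrite mulr_ge0 ?sqr_ge0 ?mulr_ge0 ?(ltW l0).
lra.
Qed.

Lemma arith_entry lam kap : 0 < lam -> 1 <= kap ->
  2 * kap * lam + 14 * kap ^+ 2 * lam <= 16 * kap ^+ 2 * lam.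
Proof.
move=> l0 k1; have : kap * lam <= kap ^+ 2 * lam.
  by rewrite ler_wpM2r ?(ltW l0)// expr2 ler_peMl//; lra.
lra.
Qed.

Lemma arith_S lam kap theta w : 0 < lam -> 1 <= kap -> w * kap <= theta ->
  0 <= theta -> 0 <= w ->
  w * (16 * kap ^+ 2 * lam) + (theta * lam + 50 * kap ^+ 2 * theta * lam) <=
  70 * kap ^+ 2 * theta * lam.
Proof.
move=> l0 k1 wk t0 w0.
have h1 : w * kap * (kap * lam) <= theta * (kap * lam).
  by rewrite ler_wpM2r// mulr_ge0 ?(ltW l0)//; lra.
have h2 : kap * (theta * lam) <= kap ^+ 2 * (theta * lam).
  by rewrite ler_wpM2r ?mulr_ge0 ?(ltW l0)// expr2 ler_peMl//; lra.
have h3 : theta * lam <= kap * (theta * lam).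
  by rewrite ler_peMl// mulr_ge0 ?(ltW l0).
have h4 : 0 <= kap ^+ 2 * (theta * lam).
  by rewrite mulr_ge0 ?sqr_ge0 ?mulr_ge0 ?(ltW l0).
lra.
Qed.

Lemma arith_L21 lam kap theta w e s : 0 < lam -> 1 <= kap -> w * kap <= theta ->
  0 <= w -> theta * lam <= e -> 0 <= theta -> s ^+ 2 <= 2 * kap * lam ->
  w * (8 * kap) * s * s + (13 * kap * theta * (2 * kap * lam) + kap * e) <=
  43 * kap ^+ 2 * e.
Proof.
move=> l0 k1 wk w0 te t0 s2.
have h0 : w * kap * s ^+ 2 <= theta * (2 * kap * lam).
  by rewrite ler_pM ?sqr_ge0 ?mulr_ge0//; lra.
have h1 : kap * (theta * lam) <= kap * e by rewrite ler_wpM2l//; lra.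
have e0 : 0 <= e by rewrite (le_trans _ te)// mulr_ge0 ?(ltW l0).
have h2 : kap * e <= kap ^+ 2 * e.
  by rewrite ler_wpM2r// expr2 ler_peMl//; lra.
have h3 : kap ^+ 2 * (theta * lam) <= kap ^+ 2 * e by rewrite ler_wpM2l// sqr_ge0.
lra.
Qed.

(** Here [613 = 43 * 8 + 13 + 256], the last term from [64 * kap^2 * w * (1 + w) * s^2] with
    [w <= 1], [w * kap <= theta] and [s^2 <= 2 * kap * lam]. *)
Lemma arith_L22 lam kap theta w e s : 0 < lam -> 1 <= kap -> w * kap <= theta ->
  0 <= w -> w <= 1 -> theta * lam <= e -> 0 <= theta -> s ^+ 2 <= 2 * kap * lam ->
  43 * kap ^+ 2 * e * (8 * kap) + kap * lam * (13 * kap * theta) +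
  (w * (8 * kap) * s + 8 * kap * s) * (w * (8 * kap) * s) <= 613 * kap ^+ 3 * e.
Proof.
move=> l0 k1 wk w0 w1 te t0 s2.
have k0 : 0 <= kap by lra.
have h0 : w * kap * s ^+ 2 <= theta * (2 * kap * lam).
  by rewrite ler_pM ?sqr_ge0 ?mulr_ge0//; lra.
have h0' : kap * (w * kap * s ^+ 2) <= kap * (theta * (2 * kap * lam)).
  by rewrite ler_wpM2l.
have h0'' : w * (kap * (w * kap * s ^+ 2)) <= kap * (w * kap * s ^+ 2).
  by rewrite ler_piMl// mulr_ge0// mulr_ge0 ?sqr_ge0// mulr_ge0.
have e0 : 0 <= e by rewrite (le_trans _ te)// mulr_ge0 ?(ltW l0).
have h2 : kap ^+ 2 * e <= kap ^+ 3 * e.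
  by rewrite ler_wpM2r// [kap ^+ 3]exprS ler_peMl// sqr_ge0.
have h3 : kap ^+ 2 * (theta * lam) <= kap ^+ 2 * e by rewrite ler_wpM2l// sqr_ge0.
lra.
Qed.

Lemma arith_total kap e f g : 1 <= kap -> 0 <= e ->
  e + 43 * kap ^+ 2 * e + (43 * kap ^+ 2 * e + (613 * kap ^+ 3 * e + (f + g))) <=
  700 * kap ^+ 3 * e + (f + g).
Proof.
move=> k1 e0.
have h2 : kap ^+ 2 * e <= kap ^+ 3 * e.
  by rewrite ler_wpM2r// [kap ^+ 3]exprS ler_peMl// sqr_ge0.
have h1 : e <= kap ^+ 2 * e by rewrite ler_peMl// exprn_ege1.
lra.
Qed.

End StepArithmetic.

(** * Error analysis of one recursive step *)

Section CholeskyStep.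
Variables (R : realType) (p : nat) (M M' : 'M[R[i]]_(p + p)).
Variables (lam kap theta w : R).
Hypotheses (lam0 : 0 < lam) (kap1 : 1 <= kap) (w0 : 0 <= w).
Hypotheses (wk : w * kap <= theta) (theta4 : theta <= 4^-1).
Hypothesis hM : M' ^t* = M'.
Hypothesis M'ge : forall x, lam * vnorm x ^+ 2 <= ip x (M' *m x).
Hypothesis M'le : forall x, ip x (M' *m x) <= kap * lam * vnorm x ^+ 2.
Hypothesis MM' : specnorm (M - M') <= theta * lam.

Let A := ulsubmx M.
Let B := dlsubmx M.
Let C := drsubmx M.
Let A' := ulsubmx M'.
Let B' := dlsubmx M'.
Let C' := drsubmx M'.

Lemma step_theta_ge : w <= theta.
Proof. by apply: le_trans wk; rewrite ler_peMr. Qed.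

Lemma step_theta_ge0 : 0 <= theta.
Proof. exact: le_trans step_theta_ge. Qed.

Lemma step_norm : specnorm M' <= kap * lam.
Proof.
apply: psd_specnorm_le => // [|x]; first by rewrite mulr_gt0// (lt_le_trans ltr01).
by rewrite M'le andbT (le_trans _ (M'ge x))// mulr_ge0 ?sqr_ge0 ?ltW.
Qed.

Lemma step_blocks_norm :
  [/\ specnorm A' <= kap * lam, specnorm B' <= kap * lam & specnorm C' <= kap * lam].
Proof.
by split; apply: le_trans step_norm;
  [exact: specnorm_ulsubmx|exact: specnorm_dlsubmx|exact: specnorm_drsubmx].
Qed.

Lemma step_blocks_dist :
  [/\ specnorm (A - A') <= theta * lam, specnorm (B - B') <= theta * lam &
      specnorm (C - C') <= theta * lam].
Proof.
split; apply: le_trans MM'.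
- have -> : A - A' = ulsubmx (M - M') by apply/matrixP => i j; rewrite !mxE.
  exact: specnorm_ulsubmx.
- have -> : B - B' = dlsubmx (M - M') by apply/matrixP => i j; rewrite !mxE.
  exact: specnorm_dlsubmx.
- have -> : C - C' = drsubmx (M - M') by apply/matrixP => i j; rewrite !mxE.
  exact: specnorm_drsubmx.
Qed.

Lemma step_near_norm (P P' : 'M[R[i]]_p) : specnorm (P - P') <= theta * lam ->
  specnorm P' <= kap * lam -> specnorm P <= 2 * kap * lam.
Proof.
move=> PP' P'k; apply: (le_trans (specnorm_near PP' P'k)).
exact: arith_near.
Qed.

Lemma step_invA_ref : A' \in unitmx /\ specnorm (invmx A') <= lam^-1.
Proof.
by apply: coercive_unitmx => // x; have /andP[] := ulsubmx_form M'ge M'le x.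
Qed.

Lemma step_invA : A \in unitmx /\ specnorm (invmx A) <= 2 * lam^-1.
Proof.
have [AA' _ _] := step_blocks_dist.
have -> : 2 * lam^-1 = (lam / 2)^-1 by rewrite invf_div.
apply: coercive_unitmx => [|x]; first by rewrite divr_gt0.
have /andP[A'x _] := ulsubmx_form M'ge M'le x.
apply: le_trans (ip_near_ge AA' A'x).
by rewrite ler_wpM2r ?sqr_ge0// arith_half.
Qed.

Variables Z W X : 'M[R[i]]_p.
Hypothesis HZ : specnorm (Z - invmx A) <= w * specnorm (invmx A).
Hypothesis HW : specnorm (W - B *m Z) <= w * specnorm B * specnorm Z.
Hypothesis HX : specnorm (X - W *m B ^t*) <= w * specnorm W * specnorm (B ^t*).

Let W' := B' *m invmx A'.
Let Y := B' *m invmx A' *m B' ^t*.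

Lemma step_Z : specnorm (Z - invmx A') <= 4 * theta * lam^-1 /\
  specnorm Z <= 3 * lam^-1.
Proof.
have [uA nA] := step_invA; have [uA' nA'] := step_invA_ref.
have [AA' _ _] := step_blocks_dist.
have ZA' : specnorm (Z - invmx A') <= 4 * theta * lam^-1.
  have h := specnorm_invmx_dist uA uA' nA nA' AA'.
  have hw : w * specnorm (invmx A) <= w * (2 * lam^-1) by rewrite ler_wpM2l.
  apply: (le_trans (specnorm_trans (le_trans HZ hw) h)).
  exact: arith_Z step_theta_ge.
split=> //; apply: (le_trans (specnorm_near ZA' nA')).
exact: arith_Z_norm.
Qed.

Lemma step_W_ref : specnorm W' <= kap.
Proof.
have [_ nB' _] := step_blocks_norm; have [_ nA'] := step_invA_ref.
by have := specnormM_le nB' nA'; rewrite mulfK ?gt_eqF.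
Qed.

Lemma step_W : specnorm (W - W') <= 13 * kap * theta /\ specnorm W <= 8 * kap.
Proof.
have [_ BB' _] := step_blocks_dist; have [_ nB' _] := step_blocks_norm.
have nB := step_near_norm BB' nB'; have [ZA' nZ] := step_Z.
have hw : w * specnorm B * specnorm Z <= w * (2 * kap * lam) * (3 * lam^-1).
  by rewrite ler_pM ?mulr_ge0 ?specnorm_ge0 ?ler_wpM2l.
have WW' : specnorm (W - W') <= 13 * kap * theta.
  apply: (le_trans (specnorm_trans (le_trans HW hw) (specnorm_distM BB' nZ nB' ZA'))).
  exact: arith_W step_theta_ge0.
split=> //; apply: (le_trans (specnorm_near WW' step_W_ref)).
exact: arith_W_norm.
Qed.

Lemma step_X : specnorm (X - Y) <= 50 * kap ^+ 2 * theta * lam.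
Proof.
have [_ BB' _] := step_blocks_dist; have [_ nB' _] := step_blocks_norm.
have nB := step_near_norm BB' nB'; have [WW' nW] := step_W.
rewrite -specnorm_dist_adj in BB'; rewrite -specnorm_adj in nB.
have h : w * specnorm W * specnorm (B ^t*) <= w * (8 * kap) * (2 * kap * lam).
  by rewrite ler_pM ?mulr_ge0 ?specnorm_ge0 ?ler_wpM2l.
apply: (le_trans (specnorm_trans (le_trans HX h)
  (specnorm_distM WW' nB step_W_ref BB'))).
exact: arith_X step_theta_ge0.
Qed.

Lemma step_Y_adj : Y ^t* = Y.
Proof. exact: schur_adj. Qed.

Lemma step_X_norm : specnorm X <= 14 * kap ^+ 2 * lam.
Proof.
have [_ nB' _] := step_blocks_norm; rewrite -specnorm_adj in nB'.
apply: (le_trans (specnorm_near step_X (specnormM_le step_W_ref nB'))).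
exact: arith_X_norm.
Qed.

Let S := C' - HERMre X.

Lemma step_S_adj : S ^t* = S.
Proof. by have [_ _ hC] := herm_blocks hM; rewrite adjB HERMre_adj hC. Qed.

(** [HERMre] is additive and fixes the Hermitian [Y], so the difference is [- HERMre (X - Y)]. It is
    controlled through entries, whence [p^2]; this is the displacement of the reference matrix that
    the slack pays for. *)
Lemma step_S_ref :
  specnorm (S - (C' - Y)) <= p%:R ^+ 2 * (50 * kap ^+ 2 * theta * lam).
Proof.
have -> : S - (C' - Y) = - HERMre (X - Y).
  rewrite HERMreB (HERMre_fixed step_Y_adj) /S opprB [in RHS]opprB.
  by rewrite addrC addrA subrK.
rewrite specnormN (le_trans (specnorm_HERMre _))//.
by rewrite ler_wpM2l ?sqr_ge0// step_X.
Qed.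

(** Off the diagonal [HERM X] and [HERMre X] cancel. There remain [C - C'], the imaginary diagonal
    of [X], and the rounding of the subtraction, whose [p^2] comes with a factor [u] and is absorbed
    by [w]. *)
Lemma step_S (u : R) (St : 'M[R[i]]_p) : 0 <= u -> p%:R ^+ 2 * u <= w ->
  (forall i j, rounds_to u (C i j - HERM X i j) (St i j)) ->
  specnorm (St - S) <= 70 * kap ^+ 2 * theta * lam.
Proof.
move=> u0 puw HS.
have [_ _ CC'] := step_blocks_dist; have [_ _ nC'] := step_blocks_norm.
have nC := step_near_norm CC' nC'.
have H1 : specnorm (St - (C - HERM X)) <= w * (16 * kap ^+ 2 * lam).
  have k0 : 0 <= 16 * kap ^+ 2 * lam.
    by rewrite mulr_ge0 ?(ltW lam0)// mulr_ge0 ?sqr_ge0.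
  have Hij i j : normc ((St - (C - HERM X)) i j) <= u * (16 * kap ^+ 2 * lam).
    have [d [du E]] := HS i j.
    have -> : (St - (C - HERM X)) i j = d * (C i j - HERM X i j).
      have -> : (St - (C - HERM X)) i j = St i j - (C i j - HERM X i j).
        by rewrite !mxE.
      by rewrite E mulrDl mul1r addrAC subrr add0r.
    rewrite normcM ler_pM ?normc_ge0// (le_trans (normcD _ _))// normcN.
    apply: le_trans (arith_entry lam0 kap1); apply: lerD.
      exact: le_trans (normc_le_specnorm _ _ _) nC.
    exact: le_trans (normc_HERM_le _ _ _) step_X_norm.
  apply: (le_trans (specnorm_entries (mulr_ge0 u0 k0) Hij)).
  by rewrite [leLHS]mulrA ler_wpM2r.
have H2 : specnorm (C - HERM X - S) <= theta * lam + 50 * kap ^+ 2 * theta * lam.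
  have -> : C - HERM X - S = (C - C') - (HERM X - HERMre X).
    by rewrite /S !opprB addrACA [RHS]addrACA [- C' + _]addrC.
  apply: specnormD_le => //; rewrite specnormN.
  exact: le_trans (specnorm_HERM_HERMre _ step_Y_adj) step_X.
apply: (le_trans (specnorm_trans H1 H2)).
exact: arith_S step_theta_ge0 w0.
Qed.

Variables (L11 L21 L22 : 'M[R[i]]_p) (e f g : R).
Hypothesis HL11 : specnorm (L11 *m L11 ^t* - A') <= e.
Hypotheses (te : theta * lam <= e) (ek : e <= kap * lam).
Hypothesis HL21 : specnorm (L21 - W *m L11) <= w * specnorm W * specnorm L11.
Hypothesis HL22 : specnorm (L22 *m L22 ^t* - S) <= f.
Hypothesis HS : specnorm (S - (C' - Y)) <= g.

Let s := specnorm L11.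
Let s0 : 0 <= s := specnorm_ge0 L11.

Lemma step_L11_norm : specnorm (L11 *m L11 ^t*) <= 2 * kap * lam.
Proof.
have [nA' _ _] := step_blocks_norm; apply: (le_trans (specnorm_near HL11 nA')).
apply: (le_trans (lerD ek (lexx _))).
by rewrite -mulrA mulr_natl mulr2n.
Qed.

Lemma step_L11_sqr : s ^+ 2 <= 2 * kap * lam.
Proof. exact: le_trans (specnorm_mul_adj _) step_L11_norm. Qed.

Lemma step_L21_err : specnorm (L21 - W *m L11) <= w * (8 * kap) * s.
Proof.
by have [_ nW] := step_W; apply: (le_trans HL21); rewrite ler_wpM2r// ler_wpM2l.
Qed.

Lemma step_L21_norm : specnorm L21 <= w * (8 * kap) * s + 8 * kap * s.
Proof.
have [_ nW] := step_W; apply: specnorm_near step_L21_err _.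
exact: specnormM_le.
Qed.

Lemma step_WA : W' *m A' = B'.
Proof. by have [uA' _] := step_invA_ref; rewrite mulmxKV. Qed.

Lemma step_L21 : specnorm (L21 *m L11 ^t* - B') <= 43 * kap ^+ 2 * e.
Proof.
have [WW' nW] := step_W.
have -> : L21 *m L11 ^t* - B' = (L21 - W *m L11) *m L11 ^t* +
    (W *m (L11 *m L11 ^t*) - W' *m A').
  by rewrite step_WA mulmxBl addrA -mulmxA subrK.
have nL : specnorm (L11 ^t*) <= s by rewrite specnorm_adj.
apply: (le_trans (specnormD_le (specnormM_le step_L21_err nL)
  (specnorm_distM WW' step_L11_norm step_W_ref HL11))).
exact: arith_L21 step_theta_ge0 step_L11_sqr.
Qed.

Lemma step_L21_sqr : specnorm (L21 *m L21 ^t* - Y) <= 613 * kap ^+ 3 * e.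
Proof.
have [WW' nW] := step_W; have [_ nB' _] := step_blocks_norm.
have [hA _ _] := herm_blocks hM; rewrite -/A' in hA.
have EY : Y = B' *m W' ^t* by rewrite /W' adjM adjV hA mulmxA.
have -> : L21 *m L21 ^t* - Y = (L21 *m L11 ^t* *m W ^t* - B' *m W' ^t*) +
    L21 *m (L21 - W *m L11) ^t*.
  rewrite EY adjB (adjM W L11) mulmxBr [L21 *m (_ *m _)]mulmxA.
  by rewrite [RHS]addrC addrA subrK.
rewrite -specnorm_adj in nW; rewrite -specnorm_dist_adj in WW'.
have eE : specnorm ((L21 - W *m L11) ^t*) <= w * (8 * kap) * s.
  by rewrite specnorm_adj step_L21_err.
apply: (le_trans (specnormD_le (specnorm_distM step_L21 nW nB' WW')
  (specnormM_le step_L21_norm eE))).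
apply: arith_L22 step_theta_ge0 step_L11_sqr => //.
by apply: (le_trans step_theta_ge); rewrite (le_trans theta4)// invf_le1// ler1n.
Qed.

(** The lower right block telescopes through [Y] and [S]: the error of [L21 L21^*], that of
    [L22 L22^*] relative to [S], and the displacement of [S] from the exact Schur complement. *)
Lemma step_L :
  specnorm (block_mx L11 0 L21 L22 *m (block_mx L11 0 L21 L22) ^t* - M') <=
  700 * kap ^+ 3 * e + (f + g).
Proof.
have [_ hB _] := herm_blocks hM; rewrite -/B' in hB.
have -> : block_mx L11 0 L21 L22 *m (block_mx L11 0 L21 L22) ^t* - M' =
  block_mx (L11 *m L11 ^t* - A') ((L21 *m L11 ^t* - B') ^t*) (L21 *m L11 ^t* - B')
    (L21 *m L21 ^t* - Y + ((L22 *m L22 ^t* - S) + (S - (C' - Y)))).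
  rewrite -[in LHS](submxK M') adj_block_mx mulmx_block opp_block_mx add_block_mx.
  rewrite adjB adjM trmxCK hB trmx0 map_mx0 !mulmx0 !mul0mx !addr0.
  congr block_mx; rewrite [_ - S + _]addrA subrK opprB.
  rewrite [_ + (Y - C')]addrA [RHS]addrA; congr (_ - _).
  by rewrite [_ + Y]addrC addrA subrK.
have e0 : 0 <= e by apply: le_trans te; rewrite mulr_ge0 ?step_theta_ge0 ?ltW.
have ur : specnorm ((L21 *m L11 ^t* - B') ^t*) <= 43 * kap ^+ 2 * e.
  by rewrite specnorm_adj step_L21.
apply: (le_trans (specnorm_block_mx HL11 ur step_L21
  (specnormD_le step_L21_sqr (specnormD_le HL22 HS)))).
exact: arith_total.
Qed.

End CholeskyStep.

(** * The square root of a 1 x 1 matrix *)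

Section BaseCase.
Variable R : realType.

Lemma arith_sqrt (N nu u r t a : R) : 0 <= u -> u <= 1 -> u * N <= nu ->
  nu <= N -> 0 <= r -> r <= N -> 0 <= t -> t - 1 <= u -> 1 - t <= u ->
  a - r <= nu -> r - a <= nu -> 0 <= a -> `|t ^+ 2 * a - r| <= 7 * nu.
Proof.
move=> u0 u1 uN nuN r0 rN t0 t1 t1' ar ra a0.
have aN : u * a <= 2 * nu.
  have : u * a <= u * (2 * N) by rewrite ler_wpM2l//; lra.
  lra.
have ta : (t - 1) * a <= u * a by rewrite ler_wpM2r.
have ta' : (1 - t) * a <= u * a by rewrite ler_wpM2r.
have h1 : (t + 1) * ((t - 1) * a) <= (t + 1) * (u * a) by rewrite ler_wpM2l//; lra.
have h2 : (t + 1) * ((1 - t) * a) <= (t + 1) * (u * a) by rewrite ler_wpM2l//; lra.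
have h3 : (t + 1) * (u * a) <= 3 * (u * a).
  by rewrite ler_wpM2r ?mulr_ge0//; lra.
rewrite ler_norml; apply/andP; split; lra.
Qed.

(** The entry [z] may be non-real, but [s s^* = |1 + d|^2 |z|] forgets its argument. The [7] is one
    [nu] from [|z|] against the reference, plus [3 u |z| <= 6 nu] from the squared rounding factor;
    it forces [7 <= q] later. *)
Lemma sqrt_step (M M' : 'M[R[i]]_1) (s : R[i]) (N nu u : R) :
  0 <= u -> u <= 1 -> u * N <= nu -> nu <= N -> M' ^t* = M' ->
  (forall x, 0 <= ip x (M' *m x)) -> specnorm M' <= N ->
  specnorm (M - M') <= nu -> rounds_to u (sqrtc (M 0 0)) s ->
  specnorm (s%:M *m (s%:M : 'M[R[i]]_1) ^t* - M') <= 7 * nu.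
Proof.
move=> u0 u1 uN nuN hM M'ge M'N MM' [d [du sE]].
set z := M 0 0 in sE; set r := Re (M' 0 0).
have M'E : M' 0 0 = r%:C.
  by rewrite -(HERMre_fixed hM) !mxE eqxx.
have r0 : 0 <= r.
  have := M'ge 1%:M; rewrite /ip mulmx1 mxE big_ord1 !mxE eqxx conjCE.
  by rewrite M'E /= oppr0 mul0r subr0 mul1r.
have rN : r <= N.
  apply: le_trans M'N; apply: le_trans (normc_le_specnorm M' 0 0).
  by rewrite M'E normc_real ler_norm.
have zr : normc (z - r%:C) <= nu.
  have := normc_le_specnorm (M - M') 0 0; rewrite !mxE -/z M'E => h.
  exact: le_trans MM'.
have nu0 : 0 <= nu by apply: le_trans zr; exact: normc_ge0.
have nr : normc r%:C = r by rewrite normc_real ger0_norm.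
have h1 : normc z - r <= nu.
  have := normcD (z - r%:C) r%:C; rewrite subrK nr; lra.
have h2 : r - normc z <= nu.
  have := normcD (r%:C - z) z; rewrite subrK nr.
  rewrite -(normcN (r%:C - z)) opprB; lra.
set t := normc (1 + d).
have t1 : t - 1 <= u.
  have := normcD 1 d; rewrite normc1 -/t; lra.
have t1' : 1 - t <= u.
  have := normcD (1 + d) (- d); rewrite addrK normc1 normcN -/t; lra.
have sqE : normc (sqrtc z) ^+ 2 = normc z.
  by rewrite expr2 -normcM -expr2 sqr_sqrtc.
apply: specnorm_diag => [||i]; first by rewrite mulr_ge0.
  exact: mx11_is_diag.
rewrite !ord1.
have -> : (s%:M *m (s%:M : 'M[R[i]]_1) ^t* - M') 0 0 = (t ^+ 2 * normc z - r)%:C.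
  rewrite mxE [(- M') 0 0]mxE M'E mxE big_ord1 !mxE eqxx mulr1n conjCE rmorphB.
  congr (_ - _); rewrite -sqE -exprMn -normcM -sE.
  rewrite normc_sqr; case: (s) => a b /=.
  by apply/eqP; rewrite eq_complex /= !mulrN opprK -!expr2 (mulrC b a) addNr !eqxx.
by rewrite normc_real (arith_sqrt u0 u1 uN nuN)// normc_ge0.
Qed.

End BaseCase.

(** * Growth of the error over one level *)

Section RecursionArithmetic.
Variable R : realType.
Variables (lam kap theta q P : R).
Implicit Types E : R.

(** With [P = E^k], the losses of a level are [700] from the blocks, [70] from the larger [theta] of
    the Schur complement and [50] from its displaced reference, together below [1000]. *)
Lemma arith_child E : 1 <= kap -> 0 <= theta -> 7 <= q -> 1 <= P ->
  E = 1000 * kap ^+ 3 ->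
  [/\ theta <= q * P * theta, q * P * theta <= q * (E * P) * theta,
      q * P * (70 * kap ^+ 2 * theta) <= q * (E * P) * theta,
      q * P * (70 * kap ^+ 2 * theta) + q * (50 * kap ^+ 2 * theta) <=
        q * (E * P) * theta &
      700 * kap ^+ 3 * (q * P * theta) +
        (q * P * (70 * kap ^+ 2 * theta) + q * (50 * kap ^+ 2 * theta)) <=
      q * (E * P) * theta].
Proof.
move=> k1 t0 q7 P1 ->.
have q0 : 0 <= q by lra.
have P0 : 0 <= P by lra.
set c := q * P * theta.
have c0 : 0 <= c by rewrite !mulr_ge0.
have qt0 : 0 <= q * theta by rewrite mulr_ge0.
have qt : q * theta <= c by rewrite /c mulrAC ler_peMr.
have tq : theta <= q * theta by rewrite ler_peMl//; lra.
have k2 : 1 <= kap ^+ 2 by rewrite exprn_ege1.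
have k3 : kap ^+ 2 <= kap ^+ 3 by rewrite [kap ^+ 3]exprS ler_peMl ?sqr_ge0.
have h1 : kap ^+ 2 * c <= kap ^+ 3 * c by rewrite ler_wpM2r.
have h2 : kap ^+ 2 * (q * theta) <= kap ^+ 2 * c by rewrite ler_wpM2l ?sqr_ge0.
have h3 : c <= kap ^+ 2 * c by rewrite ler_peMl.
have -> : q * (1000 * kap ^+ 3 * P) * theta = 1000 * (kap ^+ 3 * c).
  by rewrite /c; ring.
have -> : q * P * (70 * kap ^+ 2 * theta) = 70 * (kap ^+ 2 * c) by rewrite /c; ring.
have -> : q * (50 * kap ^+ 2 * theta) = 50 * (kap ^+ 2 * (q * theta)) by ring.
have -> : 700 * kap ^+ 3 * c = 700 * (kap ^+ 3 * c) by ring.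
move: (kap ^+ 3 * c) (kap ^+ 2 * c) (kap ^+ 2 * (q * theta)) h1 h2 h3.
move=> x y z h1 h2 h3.
by split; lra.
Qed.

End RecursionArithmetic.

(** * Induction on the levels *)

Section Recursion.
Variables (R : realType) (ceta cINV : R) (muINV : nat -> R).
Variables (m : machine ceta cINV muINV) (K : nat) (lam kap q w : R).
Hypotheses (lam0 : 0 < lam) (kap1 : 1 <= kap) (q7 : 7 <= q) (w0 : 0 <= w).
Hypothesis hq : forall j, (j <= K)%N -> (pow2 j)%:R ^+ 2 <= q.
Hypothesis hu : q * unit_roundoff m <= w.
Hypothesis hMM : forall j, (j <= K)%N -> forall X Y : 'M[R[i]]_(pow2 j),
  specnorm (MM m X Y - X *m Y) <= w * specnorm X * specnorm Y.
Hypothesis hINV : forall j, (j <= K)%N -> forall X : 'M[R[i]]_(pow2 j),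
  X \in unitmx -> specnorm X <= 2 * kap * lam -> specnorm (invmx X) <= 2 * lam^-1 ->
  specnorm (INV m X - invmx X) <= w * specnorm (invmx X).

Let E := 1000 * kap ^+ 3.
Let u := unit_roundoff m.
Let u0 : 0 <= u := ltW (unit_roundoff_gt0 m).
Let kap0 : 0 <= kap := le_trans ler01 kap1.

Lemma recursion_E_ge1 k : 1 <= E ^+ k.
Proof.
apply: exprn_ege1; rewrite /E -[leLHS]mulr1 ler_pM// ?ler1n//.
by rewrite exprn_ege1.
Qed.

Lemma recursion_u_le : u <= w.
Proof.
by apply: le_trans hu; rewrite ler_peMl// (le_trans _ q7)// ler1n.
Qed.

Lemma pos_slack_ge (n : nat) (M' : 'M[R[i]]_n) (c : R) : 0 <= c ->
  (forall x, (lam + c * lam) * vnorm x ^+ 2 <= ip x (M' *m x)) ->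
  forall x, lam * vnorm x ^+ 2 <= ip x (M' *m x).
Proof.
move=> c0 h x; apply: le_trans (h x); rewrite ler_wpM2r ?sqr_ge0//.
by rewrite lerDl mulr_ge0 ?(ltW lam0).
Qed.

Lemma pos_slack_le (n : nat) (M' : 'M[R[i]]_n) (c : R) : 0 <= c ->
  (forall x, ip x (M' *m x) <= (kap * lam - c * lam) * vnorm x ^+ 2) ->
  forall x, ip x (M' *m x) <= kap * lam * vnorm x ^+ 2.
Proof.
move=> c0 h x; apply: (le_trans (h x)); rewrite ler_wpM2r ?sqr_ge0//.
by rewrite gerBl mulr_ge0 ?(ltW lam0).
Qed.

Lemma near_posdefmx (n : nat) (M M' : 'M[R[i]]_n) (theta : R) : theta <= 4^-1 ->
  (forall x, lam * vnorm x ^+ 2 <= ip x (M' *m x)) ->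
  specnorm (M - M') <= theta * lam -> posdefmx M.
Proof.
move=> t4 M'ge MM'; apply: (@posdefmx_coercive _ _ _ (lam / 2)) => [|x].
  by rewrite divr_gt0.
apply: le_trans (ip_near_ge MM' (M'ge x)).
by rewrite ler_wpM2r ?sqr_ge0// arith_half.
Qed.

Lemma CHOL_near0 (M M' : 'M[R[i]]_(pow2 0)) (theta : R) :
  w * kap <= theta -> q * theta <= 4^-1 -> M' ^t* = M' ->
  (forall x, lam * vnorm x ^+ 2 <= ip x (M' *m x)) ->
  (forall x, ip x (M' *m x) <= kap * lam * vnorm x ^+ 2) ->
  specnorm (M - M') <= theta * lam ->
  exists L, [/\ CHOL m M = Some L, is_trig_mx L &
    specnorm (L *m L ^t* - M') <= q * theta * lam].
Proof.
move=> wk small hM M'ge M'le MM'.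
have wt : w <= theta by apply: le_trans wk; rewrite ler_peMr.
have t0 : 0 <= theta by exact: le_trans wt.
have tq : theta <= q * theta by rewrite ler_peMl// (le_trans _ q7)// ler1n.
have t4 : theta <= 4^-1 := le_trans tq small.
have t1 : theta <= 1 by rewrite (le_trans t4)// invf_le1// ler1n.
exists (fl_sqrt m (M 0 0))%:M; split.
- by rewrite /= asboolT//; exact: near_posdefmx MM'.
- exact: scalar_mx_is_trig.
- have M'ge0 x : 0 <= ip x (M' *m x).
    by rewrite (le_trans _ (M'ge x))// mulr_ge0 ?sqr_ge0 ?ltW.
  have h : specnorm M' <= kap * lam.
    apply: psd_specnorm_le => // [|x]; last by rewrite M'ge0 M'le.
    by rewrite mulr_gt0// (lt_le_trans ltr01).
  apply: (@le_trans _ _ (7 * (theta * lam))).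
    apply: (sqrt_step u0 _ _ _ hM M'ge0 h MM' (fl_sqrtP m _)).
    + exact: le_trans recursion_u_le (le_trans wt t1).
    + rewrite mulrA ler_pM2r//; apply: le_trans wk.
      by rewrite ler_wpM2r// recursion_u_le.
    + by rewrite ler_pM2r// (le_trans t1).
  by rewrite mulrA ler_pM2r// ler_wpM2r.
Qed.

Lemma CHOL_near k : (k <= K)%N -> forall (M M' : 'M[R[i]]_(pow2 k)) (theta : R),
  w * kap <= theta -> q * E ^+ k * theta <= 4^-1 -> M' ^t* = M' ->
  (forall x, (lam + q * E ^+ k * theta * lam) * vnorm x ^+ 2 <= ip x (M' *m x)) ->
  (forall x, ip x (M' *m x) <=
     (kap * lam - q * E ^+ k * theta * lam) * vnorm x ^+ 2) ->
  specnorm (M - M') <= theta * lam ->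
  exists L, [/\ CHOL m M = Some L, is_trig_mx L &
    specnorm (L *m L ^t* - M') <= q * E ^+ k * theta * lam].
Proof.
have q0 : 0 <= q by apply: le_trans q7.
elim: k => [|k IH] kK M M' theta wk small hM slack_ge slack_le MM'.
  have t0 : 0 <= theta by apply: le_trans wk; rewrite mulr_ge0.
  rewrite expr0 mulr1 in small slack_ge slack_le *.
  have qt0 : 0 <= q * theta by rewrite mulr_ge0.
  apply: CHOL_near0 => //; first exact: pos_slack_ge slack_ge.
  exact: pos_slack_le slack_le.
have kK' : (k <= K)%N by exact: ltnW.
have wt : w <= theta by apply: le_trans wk; rewrite ler_peMr.
have t0 : 0 <= theta by exact: le_trans wt.
have [tq qE Sq Sslack Lerr] := arith_child kap1 t0 q7 (recursion_E_ge1 k) (erefl E).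
rewrite exprS in small slack_ge slack_le *.
set P := E ^+ k in tq qE Sq Sslack Lerr small slack_ge slack_le IH *.
have qEt0 : 0 <= q * (E * P) * theta by apply: le_trans qE; exact: le_trans tq.
have M'ge := pos_slack_ge qEt0 slack_ge.
have M'le := pos_slack_le qEt0 slack_le.
have t4 : theta <= 4^-1 := le_trans tq (le_trans qE small).
have [AA' BB' CC'] := step_blocks_dist MM'.
have [nA' _ _] := step_blocks_norm lam0 kap1 hM M'ge M'le.
have [hA _ _] := herm_blocks hM.
have [uA nVA] := step_invA lam0 t4 M'ge M'le MM'.
set A := ulsubmx M in AA' uA nVA; set A' := ulsubmx M' in AA' nA' hA.
have nA := step_near_norm lam0 kap1 t4 AA' nA'.
have slackE : q * P * theta * lam <= q * (E * P) * theta * lam by rewrite ler_pM2r.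
have [L11 [EL11 tL11 HL11]] : exists L, [/\ CHOL m A = Some L, is_trig_mx L &
    specnorm (L *m L ^t* - A') <= q * P * theta * lam].
  apply: IH => //.
  - exact: le_trans small.
  - move=> x; have /andP[+ _] := ulsubmx_form slack_ge slack_le x.
    by apply: le_trans; rewrite ler_wpM2r ?sqr_ge0// lerD2l.
  - move=> x; have /andP[_ +] := ulsubmx_form slack_ge slack_le x.
    by move=> h; apply: (le_trans h); rewrite ler_wpM2r ?sqr_ge0// lerD2l lerN2.
pose B := dlsubmx M; pose Z := INV m A; pose W := MM m B Z.
pose X := MM m W (B ^t*); pose S := fl_submx m (drsubmx M) (HERM X).
have HZ : specnorm (Z - invmx A) <= w * specnorm (invmx A) by exact: hINV.
have HW : specnorm (W - B *m Z) <= w * specnorm B * specnorm Z by exact: hMM.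
have HX : specnorm (X - W *m B ^t*) <= w * specnorm W * specnorm (B ^t*).
  exact: hMM.
pose S' := drsubmx M' - HERMre X.
have hS' : S' ^t* = S' := step_S_adj hM X.
have S'ref := step_S_ref lam0 kap1 w0 wk t4 hM M'ge M'le MM' HZ HW HX.
have {}S'ref : specnorm (S' - (drsubmx M' - dlsubmx M' *m invmx A' *m dlsubmx M' ^t*))
    <= q * (50 * kap ^+ 2 * theta) * lam.
  apply: (le_trans S'ref); rewrite mulrA ler_pM2r//.
  by rewrite ler_wpM2r ?hq// mulr_ge0// mulr_ge0 ?sqr_ge0.
have HS : specnorm (S - S') <= 70 * kap ^+ 2 * theta * lam.
  apply: (step_S lam0 kap1 w0 wk t4 hM M'ge M'le MM' HZ HW HX u0).
    by apply: le_trans hu; rewrite ler_wpM2r ?hq.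
  by move=> i j; rewrite [S i j]mxE; exact: fl_subP.
have l0 : 0 < lam + q * (E * P) * theta * lam.
  by rewrite ltr_pwDl// mulr_ge0 ?(ltW lam0).
have Ssl : q * P * (70 * kap ^+ 2 * theta) * lam + q * (50 * kap ^+ 2 * theta) * lam
    <= q * (E * P) * theta * lam by rewrite -mulrDl ler_pM2r.
have [L22 [EL22 tL22 HL22]] : exists L, [/\ CHOL m S = Some L, is_trig_mx L &
    specnorm (L *m L ^t* - S') <= q * P * (70 * kap ^+ 2 * theta) * lam].
  apply: IH => //.
  - apply: (le_trans wk); rewrite ler_peMl// -[leLHS]mulr1.
    by rewrite ler_pM ?ler1n// exprn_ege1.
  - exact: le_trans small.
  (* The exact Schur complement inherits the whole slack of this level. Moving to [S'] costs
     [q * (50 * kap^2 * theta)], and by [Ssl] the rest covers the slack required with [theta]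
     replaced by [70 * kap^2 * theta]. *)
  - move=> x; have /andP[h _] := schur_form l0 hM slack_ge slack_le x.
    apply: le_trans (ip_near_ge S'ref h); rewrite ler_wpM2r ?sqr_ge0//.
    by rewrite -addrA lerD2l lerBrDr.
  - move=> x; have /andP[_ h] := schur_form l0 hM slack_ge slack_le x.
    apply: le_trans (ip_near_le S'ref h) _; rewrite ler_wpM2r ?sqr_ge0//.
    by rewrite -addrA lerD2l lerNr opprD opprK lerBrDr.
exists (block_mx L11 0 (MM m W L11) L22); split.
- rewrite /= asboolT; last exact: near_posdefmx t4 M'ge MM'.
  by rewrite -/A EL11 -/B -/Z -/W -/X -/S EL22.
- by rewrite is_trig_block_mx// eqxx tL11 tL22.
- have e1 : theta * lam <= q * P * theta * lam by rewrite ler_pM2r.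
  have e2 : q * P * theta * lam <= kap * lam.
    rewrite ler_pM2r// (le_trans qE)// (le_trans small)// (le_trans _ kap1)//.
    by rewrite invf_le1// ler1n.
  have HL21 := hMM kK' W L11.
  apply: (le_trans (step_L lam0 kap1 w0 wk t4 hM M'ge M'le MM' HZ HW HL11 e1 e2
    HL21 HL22 S'ref)).
  by rewrite mulrA -!mulrDl ler_pM2r.
Qed.

End Recursion.

(** * Condition number of a Hermitian positive definite matrix *)

Section ConditionNumber.
Variable R : realType.
Implicit Type n : nat.

Lemma hermposdef_unitmx n (M : 'M[R[i]]_n) : hermposdefmx M -> M \in unitmx.
Proof.
move=> [_ pM]; apply: injective_unitmx => x Mx.
apply/eqP; apply: contraT => /pM.
by rewrite -mulmxA Mx mulmx0 mxE ltxx.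
Qed.

Lemma hermposdef_ip_ge0 n (M : 'M[R[i]]_n) x : hermposdefmx M -> 0 <= ip x (M *m x).
Proof.
move=> [_ pM]; have [->|/pM] := eqVneq x 0; first by rewrite mulmx0 /ip mulmx0 mxE.
by rewrite -mulmxA => /ltW.
Qed.

Lemma cond_ge1 n (M : 'M[R[i]]_n) : (0 < n)%N -> M \in unitmx -> 1 <= cond M.
Proof. by move=> n0 uM; rewrite -(specnorm1 R n0) -(mulmxV uM) specnormM. Qed.

Lemma specnorm_mx11 (M : 'M[R[i]]_1) : specnorm M = normc (M 0 0).
Proof.
apply/eqP; rewrite eq_le normc_le_specnorm andbT.
apply: specnorm_diag => [||i]; [exact: normc_ge0|exact: mx11_is_diag|].
by rewrite ord1.
Qed.

(** Covers [n = 1], where the exponent [c3 * log2 n] vanishes and no power of the condition number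
    is available. *)
Lemma cond_mx11 (M : 'M[R[i]]_1) : M \in unitmx -> cond M = 1.
Proof.
move=> uM; rewrite /cond !specnorm_mx11 -normcM.
have /(congr1 (fun A : 'M[R[i]]_1 => A 0 0)) := mulmxV uM.
by rewrite mxE big_ord1 => ->; rewrite mxE eqxx normc1.
Qed.

Lemma specnorm_gt0 n (M : 'M[R[i]]_n) : (0 < n)%N -> M \in unitmx ->
  0 < specnorm M /\ 0 < specnorm (invmx M).
Proof.
move=> n0 uM; have := lt_le_trans ltr01 (cond_ge1 n0 uM); rewrite /cond.
have := specnorm_ge0 M; rewrite le_eqVlt => /orP[/eqP <-|M0].
  by rewrite mul0r ltxx.
by rewrite pmulr_rgt0.
Qed.

(** The inequality [|N y|^2 <= |N| * ip y (N y)] for [N = M^-1] and [y = M x], again without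
    eigenvalues. *)
Lemma hermposdef_coercive n (M : 'M[R[i]]_n) x : (0 < n)%N -> hermposdefmx M ->
  (specnorm (invmx M))^-1 * vnorm x ^+ 2 <= ip x (M *m x).
Proof.
move=> n0 pM; have uM := hermposdef_unitmx pM.
have [_ P0] := specnorm_gt0 n0 uM; have hM := hermsymmxE pM.1.
rewrite ler_pdivrMl//.
have := psd_vnorm_mul_sqr (M *m x) P0 (M := invmx M).
rewrite adjV hM mulKmx// ipC; apply=> // y; apply/andP; split.
  have := hermposdef_ip_ge0 (invmx M *m y) pM.
  by rewrite mulKVmx// ipC.
by apply: le_trans (norm_ip_mul_le y (lexx _)); exact: ler_norm.
Qed.

End ConditionNumber.

(** * From the induction to the input matrix *)

Section GlobalBounds.
Variables (R : realType) (ceta cINV : R) (muINV : nat -> R).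
Variables (m : machine ceta cINV muINV) (k : nat) (lam kap q w : R).
Hypotheses (lam0 : 0 < lam) (kap1 : 1 <= kap) (q7 : 7 <= q) (w0 : 0 <= w).
Hypothesis hq : forall j, (j <= k)%N -> (pow2 j)%:R ^+ 2 <= q.
Hypothesis hu : q * unit_roundoff m <= w.
Hypothesis hMM : forall j, (j <= k)%N -> forall X Y : 'M[R[i]]_(pow2 j),
  specnorm (MM m X Y - X *m Y) <= w * specnorm X * specnorm Y.
Hypothesis hINV : forall j, (j <= k)%N -> forall X : 'M[R[i]]_(pow2 j),
  X \in unitmx -> specnorm X <= 2 * kap * lam -> specnorm (invmx X) <= 2 * lam^-1 ->
  specnorm (INV m X - invmx X) <= w * specnorm (invmx X).

(** [M0] is its own reference, at distance 0, and [theta] starts at its least admissible value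
    [w * kap]. The slack [c * lam] fits since [c <= 1/4] and [lam <= specnorm M0]. *)
Lemma CHOL_of_bounds (M0 : 'M[R[i]]_(pow2 k)) (eps : R) :
  hermposdefmx M0 -> 0 < eps -> eps < 1 ->
  (specnorm (invmx M0))^-1 = 2 * lam -> kap * lam = 2 * specnorm M0 ->
  q * (1000 * kap ^+ 3) ^+ k * (w * kap) <= eps / 4 ->
  exists L : 'M[R[i]]_(pow2 k),
    [/\ CHOL m M0 = Some L, is_trig_mx L &
        specnorm (L *m L ^t* - M0) <= eps * specnorm M0].
Proof.
move=> pM eps0 eps1 V2 kaplam; set th := w * kap; set E := 1000 * kap ^+ 3.
set c := q * E ^+ k * th => small.
have n0 : (0 < pow2 k)%N by rewrite pow2E expn_gt0.
have q0 : 0 <= q := le_trans (ler0n R 7) q7.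
have k0 : 0 <= kap := le_trans ler01 kap1.
have quarter : 4^-1 <= 1 :> R by rewrite invf_le1 ?ler1n ?ltr0n.
have c4 : c <= 4^-1.
  by apply: (le_trans small); rewrite ler_piMl ?invr_ge0 ?ler0n// ltW.
have hM := hermsymmxE pM.1.
have th0 : 0 <= th := mulr_ge0 w0 k0.
have E0 : 0 <= E by rewrite mulr_ge0 ?ler0n ?exprn_ge0.
have c0 : 0 <= c by rewrite mulr_ge0 ?th0// mulr_ge0 ?exprn_ge0.
have clam : c * lam <= lam.
  by rewrite ler_piMl ?(ltW lam0)// (le_trans c4).
have thlam : 0 <= th * lam by rewrite mulr_ge0 ?(ltW lam0).
have lamM : lam <= specnorm M0.
  have [_ V0] := specnorm_gt0 n0 (hermposdef_unitmx pM).
  have := cond_ge1 n0 (hermposdef_unitmx pM).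
  rewrite /cond -(ler_pdivrMr _ _ V0) mul1r V2; apply: le_trans.
  by rewrite ler_peMl ?ler1n ?(ltW lam0).
have ge1 z : (lam + c * lam) * vnorm z ^+ 2 <= ip z (M0 *m z).
  apply: le_trans (hermposdef_coercive z n0 pM); rewrite ler_wpM2r ?sqr_ge0// V2.
  by rewrite mulr_natl mulr2n lerD2l.
have le1 z : ip z (M0 *m z) <= (kap * lam - c * lam) * vnorm z ^+ 2.
  apply: (le_trans (ler_norm _)); apply: (le_trans (norm_ip_mul_le z (lexx _))).
  rewrite ler_wpM2r ?sqr_ge0// kaplam mulr_natl mulr2n -addrA lerDl subr_ge0.
  exact: le_trans lamM.
have dist0 : specnorm (M0 - M0) <= th * lam.
  rewrite subrr; apply: specnorm_le => // z.
  by rewrite mul0mx vnorm0 mulr_ge0 ?vnorm_ge0.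
have [L [EL tL HL]] := CHOL_near lam0 kap1 q7 w0 hq hu hMM hINV (leqnn k)
  (lexx _) c4 hM ge1 le1 dist0.
exists L; split=> //; apply: (le_trans HL).
apply: ler_pM => //; first exact: ltW.
by apply: (le_trans small); rewrite ler_piMr ?(ltW eps0).
Qed.

End GlobalBounds.

(** * Powers of two and real exponents *)

Section PowersOfTwo.
Variable R : realType.

Lemma pow2_gt0 k : (0 < pow2 k)%N.
Proof. by rewrite pow2E expn_gt0. Qed.

Lemma pow2_ge1 k : 1 <= (pow2 k)%:R :> R.
Proof. by rewrite ler1n pow2_gt0. Qed.

Lemma pow2_natr k : (pow2 k)%:R = 2 ^+ k :> R.
Proof. by rewrite pow2E natrX. Qed.

Lemma ln2_gt0 : 0 < ln 2 :> R.
Proof. by rewrite ln_gt0// ltr1n. Qed.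

Lemma log2_pow2 k : log2 (pow2 k)%:R = k%:R :> R.
Proof.
by rewrite /log2 pow2_natr lnXn// mulrnAl divff ?gt_eqF ?ln2_gt0.
Qed.

(** A negative exponent would reverse the monotonicity in the dimension; the absolute value gives
    one bound for all levels. *)
Lemma pow2_powR_le j k (c : R) : (j <= k)%N ->
  (pow2 j)%:R `^ c <= (pow2 k)%:R `^ `|c|.
Proof.
move=> jk; apply: (@le_trans _ _ ((pow2 j)%:R `^ `|c|)).
  by apply: ler_powR; [exact: pow2_ge1|exact: ler_norm].
apply: ge0_ler_powR => //; rewrite ?nnegrE ?ler0n//.
by rewrite ler_nat !pow2E leq_exp2l.
Qed.

Lemma cond_powR k (c : nat) (x : R) : 0 <= x ->
  x `^ (c%:R * log2 (pow2 k)%:R) = x ^+ (c * k).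
Proof. by move=> x0; rewrite log2_pow2 -natrM powR_mulrn. Qed.

End PowersOfTwo.

(** * The constants of the theorem *)

Section FinalArithmetic.
Variable R : realType.
Implicit Types (a n x y g u eps kap : R) (k : nat).

Lemma arith_bracket a n x y g : 0 <= a -> 1 <= n -> 1 <= x -> 1 <= y -> 1 <= g ->
  7 * n ^+ 2 + x + a * y * (n ^+ 32 * g) <= (8 + a) * (n ^+ 34 * x * y * g).
Proof.
move=> a0 n1 x1 y1 g1.
have n0 : 0 <= n by lra.
have h1 : n ^+ 2 <= n ^+ 34 * x * y * g.
  rewrite -[leLHS]mulr1 ler_pM ?exprn_ge0// -[leLHS]mulr1 ler_pM ?exprn_ge0//.
  by rewrite -[leLHS]mulr1 ler_pM ?exprn_ge0// ler_weXn2l.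
have h2 : x <= n ^+ 34 * x * y * g.
  rewrite -[leLHS]mulr1 ler_pM// ?(le_trans ler01)//.
  rewrite -[leLHS]mulr1 ler_pM// ?(le_trans ler01)//.
  by rewrite ler_peMl ?exprn_ege1// (le_trans ler01).
have h3 : y * (n ^+ 32 * g) <= n ^+ 34 * x * y * g.
  rewrite mulrCA mulrA ler_pM ?mulr_ge0 ?exprn_ge0 ?(le_trans ler01)//.
  rewrite ler_pM ?exprn_ge0 ?(le_trans ler01)// -[leLHS]mulr1.
  by rewrite ler_pM ?exprn_ge0// ler_weXn2l.
have := ler_wpM2l a0 h3; rewrite [a * y * _]mulrA -mulrA; lra.
Qed.

(** Origin of the constants: [54 = 2 + 18 + 34] collects [n] from [q], [E^k] and [w];
    [12 = 3 + 8 + 1] collects [kap^k] from [E^k], from the exponent of [INV] and from [w * kap];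
    [112 = 7 * 4 * 4] comes from [q], from [4 * kap] and from [eps / 4]. *)
Lemma arith_final a n x y kap u eps k : 0 <= a -> 1 <= n -> 1 <= x -> 1 <= y ->
  1 <= kap -> kap <= kap ^+ k -> 0 < u -> n = 2 ^+ k -> 0 < eps ->
  u <= eps * (1 / (112 * (8 + a) * (n ^+ 54 * x * y) * kap ^+ (12 * k))) ->
  7 * n ^+ 2 * (1000 * (4 * kap) ^+ 3) ^+ k *
  (u * (7 * n ^+ 2 + x + a * y * (4 * (4 * kap)) ^+ (8 * k)) * (4 * kap)) <= eps / 4.
Proof.
move=> a0 n1 x1 y1 k1 kk u0 nE e0 hu.
have n0 : 0 <= n by lra.
have kap0 : 0 <= kap by lra.
have x0 : 0 <= x by lra.
have y0 : 0 <= y by lra.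
have pk j : 0 <= kap ^+ j by rewrite exprn_ge0.
have H1 : (1000 * (4 * kap) ^+ 3) ^+ k <= n ^+ 18 * (kap ^+ k) ^+ 3.
  have -> : n ^+ 18 * (kap ^+ k) ^+ 3 = ((2 ^+ 6 * kap) ^+ 3) ^+ k.
    rewrite [RHS]exprAC (exprMn k (2 ^+ 6)) (exprAC 2 6) -nE.
    by move: (kap ^+ k) => G; ring.
  (* [1000] is a cube, and raising [40] to [64] makes the numerical part exactly
     [2^(18k) = n^18]. *)
  have -> : 1000 * (4 * kap) ^+ 3 = (40 * kap) ^+ 3 by ring.
  have k64 : 40 * kap <= 2 ^+ 6 * kap by rewrite ler_wpM2r// -natrX ler_nat.
  have k40 : 0 <= 40 * kap by rewrite mulr_ge0.
  have k64' : 0 <= 2 ^+ 6 * kap := le_trans k40 k64.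
  by apply: lerXn2r; rewrite ?nnegrE ?exprn_ge0//; apply: lerXn2r.
have H2 : (4 * (4 * kap)) ^+ (8 * k) = n ^+ 32 * (kap ^+ k) ^+ 8.
  have -> : 4 * (4 * kap) = 2 ^+ 4 * kap by ring.
  by rewrite nE exprMn -!exprM mulnA (mulnC k) (mulnC k).
have H3 : 1 <= (kap ^+ k) ^+ 8 by rewrite exprn_ege1// exprn_ege1.
have H4 := arith_bracket a0 n1 x1 y1 H3.
rewrite H2; set D := 112 * (8 + a) * (n ^+ 54 * x * y) * kap ^+ (12 * k) in hu.
have D0 : 0 < D.
  rewrite !mulr_gt0 ?exprn_gt0 ?(lt_le_trans ltr01)//; lra.
have uD : u * D <= eps by move: hu; rewrite mul1r ler_pdivlMr.
apply: (@le_trans _ _ (u * D / 4)); last by rewrite ler_pM2r ?invr_gt0.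
have -> : u * D / 4 = (7 * n ^+ 2) * (n ^+ 18 * (kap ^+ k) ^+ 3) *
  (u * ((8 + a) * (n ^+ 34 * x * y * (kap ^+ k) ^+ 8)) * (4 * kap ^+ k)).
  by rewrite /D mulnC exprM; field.
have b0 : 0 <= 7 * n ^+ 2 + x + a * y * (n ^+ 32 * (kap ^+ k) ^+ 8).
  by rewrite !addr_ge0 ?mulr_ge0 ?exprn_ge0.
have E0 : 0 <= 1000 * (4 * kap) ^+ 3.
  by rewrite mulr_ge0 ?ler0n ?exprn_ge0 ?mulr_ge0 ?ler0n.
have q0 : 0 <= 7 * n ^+ 2 by rewrite mulr_ge0 ?ler0n ?exprn_ge0.
have ub0 : 0 <= u * (7 * n ^+ 2 + x + a * y * (n ^+ 32 * (kap ^+ k) ^+ 8)).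
  exact: mulr_ge0 (ltW u0) b0.
apply: ler_pM.
- exact: mulr_ge0 q0 (exprn_ge0 k E0).
- exact: mulr_ge0 ub0 (mulr_ge0 (ler0n R 4) kap0).
- by rewrite ler_wpM2l ?H1 ?q0.
- apply: ler_pM; first exact: ub0.
  + exact: mulr_ge0 (ler0n R 4) kap0.
  + by rewrite (ler_pM2l u0).
  + by rewrite ler_pM2l ?ltr0n.
Qed.

(** [l], [x], [e] stand for the logarithms of [n], [cond M0] and [1 / eps]. The terms [A + c2 * l]
    lack the factor [x], so they fit under [l * x] only when [x] stays away from 0. *)
Lemma arith_bits (A c2 c3 l x x0 e : R) : 0 <= c2 -> 0 <= c3 -> 0 < x0 ->
  x0 <= x -> 1 <= l -> 0 <= e ->
  A + c2 * l + c3 * l * x + e <= ((`|A| + c2) / x0 + c3 + 1) * (l * x + e).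
Proof.
move=> c20 c30 x00 x0x l1 e0; set B := (`|A| + c2) / x0.
have B0 : 0 <= B by rewrite mulr_ge0 ?invr_ge0 ?addr_ge0 ?(ltW x00).
have h : A + c2 * l <= B * (l * x).
  apply: (@le_trans _ _ ((`|A| + c2) * l)).
    rewrite mulrDl lerD2r (le_trans (ler_norm _))// ler_peMr//.
  have -> : (`|A| + c2) * l = B * (l * x0) by rewrite /B; field; rewrite gt_eqF.
  by rewrite !ler_wpM2l// (le_trans ler01).
have lx : 0 <= l * x by rewrite mulr_ge0 ?(le_trans ler01 l1) ?(le_trans (ltW x00)).
have h1 : 0 <= B * e by rewrite mulr_ge0.
have h2 : 0 <= c3 * e by rewrite mulr_ge0.
rewrite !mulrDl !mulrDr; lra.
Qed.

End FinalArithmetic.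

(** * Correctness on a given machine *)

Section Correctness.
Variables (R : realType) (ceta cINV : R) (muINV : nat -> R) (a b : R).
Hypothesis hcINV : cINV <= 8.
Hypothesis hmu : forall n, (0 < n)%N -> muINV n <= a * n%:R `^ b.
Variables (m : machine ceta cINV muINV) (k : nat) (M0 : 'M[R[i]]_(pow2 k)) (eps : R).
Hypotheses (pM : hermposdefmx M0) (eps0 : 0 < eps) (eps1 : eps < 1).

Let n : R := (pow2 k)%:R.
Let u := unit_roundoff m.
Let u0 : 0 < u := unit_roundoff_gt0 m.
Let kap0 := cond M0.
Let kap := 4 * kap0.
Let lam := (specnorm (invmx M0))^-1 / 2.
Let q := 7 * n ^+ 2.
Let x := n `^ `|ceta|.
Let y := n `^ `|b|.
(** The three summands cover entrywise rounding, [MM], and [INV] on matrices of condition number at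
    most [4 * kap], uniformly in the level. *)
Let w := u * (q + x + `|a| * y * (4 * kap) ^+ (8 * k)).

Let uM := hermposdef_unitmx pM.
Let n0 := pow2_gt0 k.
Let n1 : 1 <= n := pow2_ge1 R k.
Let V0pos := (specnorm_gt0 n0 uM).2.
Let kap01 : 1 <= kap0 := cond_ge1 n0 uM.

Let lam0 : 0 < lam.
Proof. by rewrite divr_gt0// invr_gt0. Qed.

Let kap1 : 1 <= kap.
Proof. by rewrite -[leLHS]mulr1 ler_pM// ler1n. Qed.

Let kaplam : kap * lam = 2 * specnorm M0.
Proof. by rewrite /kap /lam /kap0 /cond; field; rewrite gt_eqF. Qed.

Let G0 : 0 <= (4 * kap) ^+ (8 * k).
Proof. by rewrite exprn_ge0// mulr_ge0// (le_trans ler01). Qed.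

Let q0 : 0 <= q.
Proof. by rewrite mulr_ge0 ?exprn_ge0 ?ler0n. Qed.

Let w0 : 0 <= w.
Proof.
rewrite mulr_ge0 ?(ltW u0)//.
by rewrite !addr_ge0 ?powR_ge0// mulr_ge0 ?mulr_ge0 ?powR_ge0.
Qed.

Let q7 : 7 <= q.
Proof. by rewrite ler_peMr ?ler0n// exprn_ege1. Qed.

Let hq j : (j <= k)%N -> (pow2 j)%:R ^+ 2 <= q.
Proof.
move=> jk; apply: (@le_trans _ _ (n ^+ 2)).
  by apply: lerXn2r; rewrite ?nnegrE ?ler0n// ler_nat !pow2E leq_exp2l.
by rewrite ler_peMl ?ler1n// sqr_ge0.
Qed.

Let qu : q * u <= w.
Proof.
rewrite mulrC ler_pM2l// -addrA lerDl addr_ge0 ?powR_ge0//.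
by rewrite mulr_ge0 ?mulr_ge0 ?powR_ge0.
Qed.

Let V2 : (specnorm (invmx M0))^-1 = 2 * lam.
Proof. by rewrite mulrC divfK ?pnatr_eq0. Qed.

Lemma correct_MM j (X Y : 'M[R[i]]_(pow2 j)) : (j <= k)%N ->
  specnorm (MM m X Y - X *m Y) <= w * specnorm X * specnorm Y.
Proof.
move=> jk; apply: (le_trans (MM_P m X Y)).
rewrite !ler_wpM2r ?specnorm_ge0// mulrC ler_pM2l//.
apply: (le_trans (pow2_powR_le _ jk)); rewrite -/n -/x -addrA addrCA lerDl.
by rewrite addr_ge0// mulr_ge0 ?mulr_ge0 ?powR_ge0.
Qed.

(** Since [cond X >= 1], its exponent [cINV * j] may be enlarged to [8 * k] before its base is
    enlarged to [4 * kap]. *)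
Lemma correct_INV j (X : 'M[R[i]]_(pow2 j)) : (j <= k)%N -> X \in unitmx ->
  specnorm X <= 2 * kap * lam -> specnorm (invmx X) <= 2 * lam^-1 ->
  specnorm (INV m X - invmx X) <= w * specnorm (invmx X).
Proof.
move=> jk uX nX nVX; apply: (le_trans (INV_P m uX)).
rewrite ler_wpM2r ?specnorm_ge0//.
have cX1 : 1 <= cond X by apply: cond_ge1 => //; exact: pow2_gt0.
have cX : cond X <= 4 * kap.
  have -> : 4 * kap = 2 * kap * lam * (2 * lam^-1) by field; rewrite gt_eqF.
  by rewrite ler_pM ?specnorm_ge0.
have hG : cond X `^ (cINV * log2 (pow2 j)%:R) <= (4 * kap) ^+ (8 * k).
  apply: (@le_trans _ _ (cond X `^ (8 * k)%:R)).
    apply: ler_powR => //; rewrite log2_pow2 natrM.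
    apply: (@le_trans _ _ (8 * j%:R)); first by rewrite ler_wpM2r ?ler0n.
    by rewrite ler_wpM2l// ler_nat.
  rewrite powR_mulrn ?(le_trans ler01)//.
  by apply: lerXn2r => //; rewrite nnegrE (le_trans ler01)// (le_trans cX1).
have hmuj : muINV (pow2 j) <= `|a| * y.
  apply: (le_trans (hmu (pow2_gt0 j))).
  apply: (@le_trans _ _ (`|a| * (pow2 j)%:R `^ b)).
    by rewrite ler_wpM2r ?powR_ge0// ler_norm.
  by rewrite ler_wpM2l// pow2_powR_le.
have y0 : 0 <= `|a| * y by rewrite mulr_ge0 ?powR_ge0.
rewrite [muINV _ * u]mulrC -mulrA ler_pM2l//.
apply: (@le_trans _ _ (`|a| * y * cond X `^ (cINV * log2 (pow2 j)%:R))).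
  by rewrite ler_wpM2r ?powR_ge0.
apply: (le_trans (ler_wpM2l y0 hG)); rewrite lerDr.
by rewrite addr_ge0 ?mulr_ge0 ?exprn_ge0 ?ler0n ?powR_ge0.
Qed.

Lemma CHOL_correct :
  u <= chol_roundoff (112 * (8 + `|a|)) (54 + `|ceta| + `|b|) 12 M0 eps ->
  exists L : 'M[R[i]]_(pow2 k),
    [/\ CHOL m M0 = Some L, is_trig_mx L &
        specnorm (L *m L ^t* - M0) <= eps * specnorm M0].
Proof.
rewrite /chol_roundoff -/n -/kap0 => hu.
have k0 : 0 <= kap0 by rewrite (le_trans ler01).
have hx : 1 <= x by rewrite -(powRr0 n) ler_powR.
have hy : 1 <= y by rewrite -(powRr0 n) ler_powR.
have nn0 : n != 0 by rewrite gt_eqF// (lt_le_trans ltr01).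
have nE : n = 2 ^+ k by rewrite /n pow2_natr.
have nP : n `^ (54 + `|ceta| + `|b|) = n ^+ 54 * x * y.
  by rewrite powRD ?nn0 ?implybT// powRD ?nn0 ?implybT// (powR_mulrn 54) ?ler0n.
rewrite nP (cond_powR k 12 k0) in hu.
(* For [k = 0] this holds only because a 1 x 1 matrix has condition number 1. *)
have kk : kap0 <= kap0 ^+ k.
  have [kE|kpos] := posnP k; last first.
    by rewrite -[leLHS]expr1; apply: ler_weXn2l.
  suff -> : kap0 = 1 by rewrite expr1n.
  rewrite /kap0; move: (M0) (uM); rewrite kE => M1 uM1; exact: cond_mx11.
have small := arith_final (normr_ge0 a) n1 hx hy kap01 kk u0 nE eps0 hu.
exact: (CHOL_of_bounds lam0 kap1 q7 w0 hq qu (fun j jk X Y => correct_MM X Y jk)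
  (fun j jk X uX nX nVX => correct_INV jk uX nX nVX) pM eps0 eps1 V2 kaplam small).
Qed.

End Correctness.

(** * Bits of precision *)

Section BitsOfPrecision.
Variable R : realType.

Lemma chol_roundoff_bits (c1 c2 c3 kappa0 : R) : 0 < c1 -> 0 < c2 -> 0 < c3 ->
  1 < kappa0 ->
  exists K : R, 0 < K /\
    forall (k : nat) (M0 : 'M[R[i]]_(pow2 k)) (eps : R),
      hermposdefmx M0 -> kappa0 <= cond M0 -> 0 < eps < 1 ->
      log2 (1 / chol_roundoff c1 c2 c3 M0 eps) <=
        K * (log2 (pow2 k)%:R * log2 (cond M0) + log2 (1 / eps)).
Proof.
move=> c10 c20 c30 k01.
have ln2 := ln2_gt0 R.
have l0 : 0 < log2 kappa0 by rewrite divr_gt0// ln_gt0.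
exists ((`|log2 c1| + c2) / log2 kappa0 + c3 + 1); split.
  by rewrite ltr_wpDl// addr_ge0 ?mulr_ge0 ?invr_ge0 ?addr_ge0// ltW.
move=> k M0 eps pM kM /andP[e0 e1].
have uM := hermposdef_unitmx pM.
(* A condition number above 1 excludes [n = 1], so [log2 n >= 1]. *)
have kpos : (0 < k)%N.
  rewrite lt0n; apply/eqP => kE; move: M0 pM kM uM; rewrite kE => M1 _ kM uM1.
  by move: (lt_le_trans k01 kM); rewrite cond_mx11// ltxx.
have kM0 : 0 < cond M0 by rewrite (lt_le_trans ltr01)// (le_trans (ltW k01)).
have n0 : 0 < (pow2 k)%:R :> R by rewrite ltr0n pow2_gt0.
have pow_gt0 (x y : R) : 0 < x -> 0 < x `^ y by exact: powR_gt0.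
have -> : log2 (1 / chol_roundoff c1 c2 c3 M0 eps) = log2 c1 +
    c2 * log2 (pow2 k)%:R + c3 * log2 (pow2 k)%:R * log2 (cond M0) + log2 (1 / eps).
  rewrite /chol_roundoff !mul1r invfM invrK /log2.
  rewrite lnM ?posrE ?invr_gt0 ?mulr_gt0 ?pow_gt0//.
  rewrite lnM ?posrE ?mulr_gt0 ?pow_gt0// lnM ?posrE ?pow_gt0// !ln_powR.
  by field; rewrite gt_eqF.
apply: arith_bits => //; try exact: ltW.
- by rewrite ler_pM2r ?invr_gt0// ler_ln ?posrE// (lt_trans ltr01).
- by rewrite log2_pow2 ler1n.
- by rewrite divr_ge0 ?(ltW ln2)// ln_ge0// mul1r invf_ge1// ltW.
Qed.

End BitsOfPrecision.

Theorem theorem6p6 (R : realType) (ceta cINV : R) (muINV : nat -> R)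
    (hcINV : cINV <= 8) (hmuINV : poly_bounded muINV) :
  exists c1 c2 c3 : R,
    [/\ 0 < c1, 0 < c2 & 0 < c3] /\
    (forall (k : nat) (M0 : 'M[R[i]]_(pow2 k)) (eps : R)
        (m : machine ceta cINV muINV),
      hermposdefmx M0 -> 0 < eps < 1 ->
      unit_roundoff m <= chol_roundoff c1 c2 c3 M0 eps ->
      exists L : 'M[R[i]]_(pow2 k),
        [/\ CHOL m M0 = Some L,
            is_trig_mx L &
            specnorm (L *m L ^t* - M0) <= eps * specnorm M0]) /\
    (forall kappa0 : R, 1 < kappa0 ->
      exists K : R, 0 < K /\
        forall (k : nat) (M0 : 'M[R[i]]_(pow2 k)) (eps : R),
          hermposdefmx M0 -> kappa0 <= cond M0 -> 0 < eps < 1 ->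
          log2 (1 / chol_roundoff c1 c2 c3 M0 eps) <=
            K * (log2 (pow2 k)%:R * log2 (cond M0) + log2 (1 / eps))).
Proof.
have [a [b hmu]] := hmuINV.
have c10 : 0 < 112 * (8 + `|a|) by rewrite mulr_gt0// ltr_pwDl.
have c20 : 0 < 54 + `|ceta| + `|b| by rewrite ltr_pwDl// ltr_pwDl.
(* The witnesses depend only on [ceta] and on the polynomial bound for [muINV], hence precede
   machine, dimension and matrix. *)
exists (112 * (8 + `|a|)), (54 + `|ceta| + `|b|), 12; split; first by split.
split=> [k M0 eps m pM /andP[e0 e1] hu|kappa0 k1].
  exact: (CHOL_correct hcINV hmu pM e0 e1 hu).
exact: chol_roundoff_bits.
Qed.
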